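(* For every peak composition $\alpha$, the map $\Xi_\alpha:\mathrm{SPIT}(\alpha)\to\mathrm{SPIT}(\alpha)$ (constructed in the context) is a bijection.
   Context: A composition $\alpha=(\alpha_1,\dots,\alpha_k)$ of $n=|\alpha|$ is a finite list of positive integers with sum $n$; $\ell(\alpha)=k$. Its diagram $D(\alpha)$ is the left-justified array with $\alpha_i$ boxes in row $i$, rows numbered from bottom to top; box $(i,j)$ lies in column $i$ and row $j$, and $T_{i,j}$ is the entry of a filling $T$ there. $c_i(\alpha)$ is the number of boxes in column $i$ of $D(\alpha)$. A peak composition is a composition all of whose parts, except possibly the last, are greater than $1$. A standard immaculate tableau (SIT) of shape $\alpha$ is a filling of $D(\alpha)$ with the numbers $1,\dots,n$, each used once, whose rows increase from left to right and whose first column increases from bottom to top. For a peak composition $\alpha$ of $n$, a standard peak immaculate tableau (SPIT) of shape $\alpha$ is an SIT of shape $\alpha$ such that for every $1\le k\le n$ the boxes with entries $\le k$ form the diagram of a peak composition. $\mathrm{SPIT}(\alpha)$ is the set of these. A generalized SPIT of shape $\alpha$ is a filling of $D(\alpha)$ with distinct positive integers $a_1<\cdots<a_{|\alpha|}$ such that replacing each $a_i$ by $i$ gives an SPIT of shape $\alpha$. $|T|$ is the number of boxes of $T$. Column reading $\mathrm{w}_{\rm c}(T)$: read entries column by column starting from the leftmost column, each column from bottom to top. Row reading $\mathrm{w}_{\rm r}(T)$: read entries row by row starting from the uppermost row, each row from left to right. For a word $w$ with distinct positive integer letters, $\mathrm{Des}(w)$ (resp. $\mathrm{Asc}(w)$)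 is the set of $i$ such that $i$ and $i+1$ both occur in $w$ and $i$ is to the right (resp. left) of $i+1$. $T_{[1:j]}$ is the restriction of $T$ to its first $j$ boxes, boxes being listed column by column from left to right and from bottom to top in each column. $s_i\cdot T$ is obtained from $T$ by swapping the entries $i$ and $i+1$ (both occurring in $T$). A pair $(T,U)$ of generalized SPITs satisfies the shape-descent alignment condition if: $|U|=|T|-1$; the shape of $T$ has at least one part $\ge 3$ and $U$ has the same shape as $T_{[1:|U|]}$; $U$ and $T_{[1:|U|]}$ have the same set of entries; and $\mathrm{Des}(\mathrm{w}_{\rm r}(U))=\mathrm{Des}(\mathrm{w}_{\rm c}(T_{[1:|U|]}))$. Algorithm applied to such a pair $(T,U)$. Let $h$ be the entry in $T$ but not in $U$, at position $(x,y)$ in $T$. Step 1: set $j:=1$ and let $U^h_1$ be $U$ with a box added at $(x,y)$ filled with $h$. Step 2: let $A_j:=\mathrm{Des}(\mathrm{w}_{\rm r}(U^h_j))\cap\mathrm{Asc}(\mathrm{w}_{\rm c}(T))$ and $B_j:=\mathrm{Asc}(\mathrm{w}_{\rm r}(U^h_j))\cap\mathrm{Des}(\mathrm{w}_{\rm c}(T))$. If $A_j=B_j=\emptyset$, return $U^h_j$; otherwise go to Step 3. Step 3: if $A_j\neq\emptyset$ let $a$ be its unique element; if $B_j\ne\emptyset$ let $b$ be its unique element. Put $z_j:=a$ if $A_j,B_j\neq\emptyset$, $b=a+1$ and $a$ is in a row strictly below $a+2$ in $U^h_j$; $z_j:=a+1$ if $A_j,B_j\ne\emptyset$, $b=a+1$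 and $a$ is in a row weakly above $a+2$ in $U^h_j$; $z_j:=a$ if $A_j\ne\emptyset$, $B_j=\emptyset$; $z_j:=b$ if $A_j=\emptyset$, $B_j\neq\emptyset$. Set $U^h_{j+1}:=s_{z_j}\cdot U^h_j$, increase $j$ by $1$, go to Step 2. The map $\Xi_\alpha$: let $\alpha$ be a peak composition of $n$ and $\mathfrak c:=c_1(\alpha)+c_2(\alpha)$. For $T\in\mathrm{SPIT}(\alpha)$ put $U_0(T):=T_{[1:\mathfrak c]}$ and, for $1\le i\le n-\mathfrak c$, let $U_i(T)$ be the filling returned by the Algorithm applied to $(T_{[1:\mathfrak c+i]},U_{i-1}(T))$. Set $\Xi_\alpha(T):=U_{n-\mathfrak c}(T)$. (It is an established fact that this construction can always be carried out — the sets $A_j,B_j$ have at most one element, the Algorithm terminates, all pairs satisfy the alignment condition — and that $\Xi_\alpha(T)\in\mathrm{SPIT}(\alpha)$.) *)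

(* Defs.v *)
From mathcomp Require Import all_boot.
From mathcomp Require Import boolp classical_sets functions.

Set Implicit Arguments.
Unset Strict Implicit.
Unset Printing Implicit Defensive.

Local Open Scope classical_set_scope.

(* |alpha| is [sumn alpha] and the length of alpha is [size alpha]. *)
Definition composition (alpha : seq nat) : bool := all (leq 1) alpha.

Definition peak_composition (alpha : seq nat) : bool :=
  composition alpha && all (leq 2) (take (size alpha).-1 alpha).

(* The diagram D(alpha): a box is a pair (column, row), both counted from 1.
   The boxes are listed column by column from left to right, and from bottom to
   top in each column. *)
Definition boxes (alpha : seq nat) : seq (nat * nat) :=
  [seq b <- [seq (i, j) | i <- iota 1 (foldr maxn 0 alpha),
                          j <- iota 1 (size alpha)]
   | b.1 <= nth 0 alpha b.2.-1].

Definition column_size (i : nat) (alpha : seq nat) : nat :=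
  count (fun b => b.1 == i) (boxes alpha).

(* A filling is the list of its rows, from the bottom row to the top row. *)
Definition filling := seq (seq nat).

Definition shape (T : filling) : seq nat := [seq size r | r <- T].

Definition entries (T : filling) : seq nat := flatten T.

Definition nboxes (T : filling) : nat := size (entries T).

Definition entry (T : filling) (b : nat * nat) : nat :=
  nth 0 (nth [::] T b.2.-1) b.1.-1.

Definition first_column (T : filling) : seq nat :=
  [seq entry T b | b <- boxes (shape T) & b.1 == 1].

Definition SIT (alpha : seq nat) : set filling :=
  [set T | [/\ shape T = alpha,
               perm_eq (entries T) (iota 1 (sumn alpha)),
               all (sorted ltn) T
             & sorted ltn (first_column T)]].

Definition SPIT (alpha : seq nat) : set filling :=
  [set T | SIT alpha T /\
     forall k, 1 <= k <= sumn alpha ->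
       exists2 beta, peak_composition beta
         & [seq b <- boxes alpha | entry T b <= k] =i boxes beta].

(* Replaces the i-th smallest entry by i. *)
Definition standardize (T : filling) : filling :=
  [seq [seq (index a (sort leq (entries T))).+1 | a <- r] | r <- T].

Definition generalized_SPIT (alpha : seq nat) : set filling :=
  [set T | [/\ peak_composition alpha, shape T = alpha, uniq (entries T),
               all (leq 1) (entries T) & SPIT alpha (standardize T)]].

Definition column_reading (T : filling) : seq nat :=
  [seq entry T b | b <- boxes (shape T)].

Definition row_reading (T : filling) : seq nat := flatten (rev T).

Definition Des (w : seq nat) : pred nat :=
  fun i => [&& i \in w, i.+1 \in w & index i.+1 w < index i w].

Definition Asc (w : seq nat) : pred nat :=
  fun i => [&& i \in w, i.+1 \in w & index i w < index i.+1 w].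

(* T_{[1:m]}; rows without any of the first m boxes are dropped. *)
Definition restrict (m : nat) (T : filling) : filling :=
  [seq r <- [seq [seq entry T b | b <- take m (boxes (shape T)) & b.2 == j]
            | j <- iota 1 (size T)]
   | r != [::]].

Definition swap_entries (i : nat) (T : filling) : filling :=
  [seq [seq (if a == i then i.+1 else if a == i.+1 then i else a) | a <- r]
  | r <- T].

Definition set_box (T : filling) (b : nat * nat) (h : nat) : filling :=
  set_nth [::] T b.2.-1 (set_nth 0 (nth [::] T b.2.-1) b.1.-1 h).

(* The row containing the entry a, counted from 0 at the bottom. *)
Definition row_of (T : filling) (a : nat) : nat := find (fun r => a \in r) T.

Definition shape_descent_aligned (T U : filling) : Prop :=
  let R := restrict (nboxes U) T in
  [/\ generalized_SPIT (shape T) T /\ generalized_SPIT (shape U) U,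
      nboxes T = (nboxes U).+1,
      has (leq 3) (shape T) /\ shape U = shape R,
      entries U =i entries R
    & Des (row_reading U) =1 Des (column_reading R)].

Definition setA (T V : filling) : pred nat :=
  predI (Des (row_reading V)) (Asc (column_reading T)).

Definition setB (T V : filling) : pred nat :=
  predI (Asc (row_reading V)) (Des (column_reading T)).

(* [swap_index T V z]: Step 3 chooses z_j = z at the current filling V = U^h_j.
   It is only related to some z when the nonempty ones among A_j and B_j are
   singletons. *)
Inductive swap_index (T V : filling) : nat -> Prop :=
| Swap_below a : setA T V =1 pred1 a -> setB T V =1 pred1 a.+1 ->
    row_of V a < row_of V a.+2 -> swap_index T V a
| Swap_above a : setA T V =1 pred1 a -> setB T V =1 pred1 a.+1 ->
    row_of V a.+2 <= row_of V a -> swap_index T V a.+1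
| Swap_A a : setA T V =1 pred1 a -> setB T V =1 pred0 -> swap_index T V a
| Swap_B b : setA T V =1 pred0 -> setB T V =1 pred1 b -> swap_index T V b.

(* [loop_returns T V W]: entering Step 2 with current filling V, the Algorithm
   terminates and returns W. *)
Inductive loop_returns (T : filling) : filling -> filling -> Prop :=
| Loop_stop V : setA T V =1 pred0 -> setB T V =1 pred0 -> loop_returns T V V
| Loop_step V z W : swap_index T V z ->
    loop_returns T (swap_entries z V) W -> loop_returns T V W.

Definition algorithm_returns (T U W : filling) : Prop :=
  shape_descent_aligned T U /\
  exists2 b, b \in boxes (shape T) /\ entry T b \notin entries U
    & loop_returns T (set_box U b (entry T b)) W.

(* [stage c T i V]: U_i(T) is defined and equal to V, where
   c = c_1(alpha) + c_2(alpha). *)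
Fixpoint stage (c : nat) (T : filling) (i : nat) (V : filling) : Prop :=
  if i is i'.+1 then
    exists2 U, stage c T i' U & algorithm_returns (restrict (c + i) T) U V
  else V = restrict c T.

(* [stage] has at most one value, which is the one [xget] picks. The default
   value [::], used if the construction could not be carried out, has shape
   [::], hence is not in [SPIT alpha] unless alpha is empty (a case in which the
   Algorithm is never applied): that Xi alpha maps SPIT alpha to itself
   therefore includes that the construction succeeds. *)
Definition Xi (alpha : seq nat) (T : filling) : filling :=
  let c := column_size 1 alpha + column_size 2 alpha in
  xget [::] [set V | stage c T (sumn alpha - c) V].

(* Main.v *)
(** Let c be the number of boxes in the first two columns. In an SPIT the entries
    of these columns increase row by row, so the row and the column reading of
    T_{[1:c]} have the same descents. When the box b in row y is added with its
    entry h, read last in the column reading, every state of the Algorithm has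
    increasing rows, i is a descent of its row reading iff i lies in a strictly
    lower row than i+1, and the entry z of b moves by adjacent swaps past entries
    of rows below y: downwards while row(z-1) < y and row(z-1) >= row(z+1), or
    upwards while row(z+1) < y and row(z-1) < row(z+1). No entry ever crosses a
    value that is still absent; since T_{x-1,y} < T_{x,y}, the next entry h is
    therefore larger than all entries of its row, and rows remain increasing.
    The final filling determines the direction of the walk and the place where it
    started, as in Foata's bijection. Hence h and the previous filling can be
    recovered, the map is injective, and it is bijective as SPIT(alpha) is
    finite. *)

Require Import Defs.
From mathcomp Require Import all_boot.
From mathcomp Require Import boolp classical_sets functions.
From mathcomp Require Import zify.
(* [functions] also defines a [restrict]. *)
Import Defs.

Set Implicit Arguments.
Unset Strict Implicit.
Unset Printing Implicit Defensive.

(** * Inequalities for SPITs, the order of boxes and prefixes of a diagram *)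

Definition rows_increase (T : filling) : Prop :=
  forall i j : nat, 0 < i -> (i.+1, j) \in boxes (shape T) ->
    entry T (i, j) < entry T (i.+1, j).

(** Local form of the peak condition: a row is started only after the row below it has received its
    second box. In a peak composition that second box exists whenever there is a row above. *)
Definition peaks_increase (T : filling) : Prop :=
  forall j : nat, 0 < j -> (1, j.+1) \in boxes (shape T) ->
    entry T (2, j) < entry T (1, j.+1).

(** The strict order in which [boxes] lists the diagram. Since a sorted list is determined by its
    members, identities between lists of boxes reduce to identities of membership. *)
Definition box_lt (b b' : nat * nat) : bool :=
  (b.1 < b'.1) || ((b.1 == b'.1) && (b.2 < b'.2)).

Lemma box_lt_trans : transitive box_lt.
Proof. by move=> [a b] [c d] [e f]; rewrite /box_lt /=; lia. Qed.

Lemma box_lt_irr : irreflexive box_lt.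
Proof. by move=> [a b]; rewrite /box_lt /=; lia. Qed.

Lemma leq_foldr_maxn (s : seq nat) i : nth 0 s i <= foldr maxn 0 s.
Proof. by elim: s i => [|x s IH] [|i] //=; rewrite leq_max ?leqnn // IH orbT. Qed.

Lemma mem_boxes alpha (b : nat * nat) :
  (b \in boxes alpha) =
  [&& 0 < b.1, 0 < b.2, b.2 <= size alpha & b.1 <= nth 0 alpha b.2.-1].
Proof.
case: b => i j; rewrite mem_filter /=.
have -> : ((i, j) \in [seq (i, j) | i <- iota 1 (foldr maxn 0 alpha),
                          j <- iota 1 (size alpha)]) =
  (i \in iota 1 (foldr maxn 0 alpha)) && (j \in iota 1 (size alpha)).
  by apply/allpairsP/andP => [[[? ?] [? ? [-> ->]]]|[? ?]] //; exists (i, j).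
by rewrite !mem_iota; have := leq_foldr_maxn alpha j.-1; lia.
Qed.

Lemma boxes_sorted alpha : sorted box_lt (boxes alpha).
Proof.
apply: (sorted_filter box_lt_trans).
rewrite sorted_pairwise; last exact: box_lt_trans.
have := iota_ltn_sorted 1 (size alpha).
have := iota_ltn_sorted 1 (foldr maxn 0 alpha).
rewrite !(sorted_pairwise ltn_trans).
elim: (iota 1 (foldr maxn 0 alpha)) => [|x s IH] //= /andP[xs ss] tt.
rewrite pairwise_cat IH // andbT; apply/andP; split.
  apply/allrelP => _ _ /mapP[j _ ->] /allpairsP[[a b] [/= ain _ ->]].
  by rewrite /box_lt /= (allP xs).
by rewrite pairwise_map; apply: sub_pairwise tt => a b /=; rewrite /box_lt /=; lia.
Qed.

Lemma boxes_uniq alpha : uniq (boxes alpha).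
Proof. exact: sorted_uniq box_lt_trans box_lt_irr _ (boxes_sorted alpha). Qed.

Lemma filter_take (A : Type) (p : pred A) m (s : seq A) :
  filter p (take m s) = take (count p (take m s)) (filter p s).
Proof.
by rewrite -{3}(cat_take_drop m s) filter_cat take_size_cat // size_filter.
Qed.

Lemma filter_down_closed (A : eqType) (e : rel A) (p : pred A) (s : seq A) :
  transitive e -> (forall x y, e x y -> p y -> p x) -> sorted e s ->
  filter p s = take (count p s) s.
Proof.
move=> etr down; rewrite (sorted_pairwise etr).
elim: s => [|x s IH] //= /andP[xs /IH ->]; case: (boolP (p x)) => px //=.
suff -> : count p s = 0 by rewrite !take0.
apply/eqP; rewrite eqn0Ngt -has_count; apply/hasPn => y ys.
by apply: contra px; apply: down; apply: (allP xs).
Qed.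

Lemma boxes_row alpha j : 0 < j <= size alpha ->
  [seq b <- boxes alpha | b.2 == j] =
  [seq (i, j) | i <- iota 1 (nth 0 alpha j.-1)].
Proof.
move=> hj; apply: (irr_sorted_eq box_lt_trans box_lt_irr).
- exact: (sorted_filter box_lt_trans) (boxes_sorted _).
- rewrite sorted_map; apply: sub_sorted (iota_ltn_sorted _ _) => a b /=.
  by rewrite /box_lt /=; lia.
move=> [a b]; rewrite mem_filter mem_boxes /=.
apply/idP/mapP => [H|[i]]; last by rewrite mem_iota => H [-> ->]; lia.
have <- : b = j by lia.
by exists a => //; rewrite mem_iota; lia.
Qed.

(** The row lengths of the first [m] boxes, with empty rows kept as zeros. Once the first two
    columns are included no zero is left, and this is the shape of the restricted filling. *)
Definition prefix_shape m (alpha : seq nat) : seq nat :=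
  [seq count (fun b => b.2 == j) (take m (boxes alpha)) | j <- iota 1 (size alpha)].

Lemma size_prefix_shape m alpha : size (prefix_shape m alpha) = size alpha.
Proof. by rewrite size_map size_iota. Qed.

Lemma nth_prefix_shape m alpha j : 0 < j <= size alpha ->
  nth 0 (prefix_shape m alpha) j.-1 =
  count (fun b => b.2 == j) (take m (boxes alpha)).
Proof.
move=> hj; rewrite (nth_map 0) ?size_iota ?nth_iota; try lia.
by rewrite add1n prednK //; lia.
Qed.

(** Within one row the boxes are listed from left to right, so a prefix of the list meets the row in
    an initial segment. *)
Lemma take_boxes_row m alpha j : 0 < j <= size alpha ->
  [seq b <- take m (boxes alpha) | b.2 == j] =
  [seq (i, j) | i <- iota 1 (nth 0 (prefix_shape m alpha) j.-1)].
Proof.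
move=> hj; rewrite nth_prefix_shape // filter_take boxes_row //.
rewrite -map_take take_iota; congr map; congr iota; apply/minn_idPl.
have := count_size (fun b : nat * nat => b.2 == j) (boxes alpha).
have : count (fun b => b.2 == j) (take m (boxes alpha)) <=
       count (fun b => b.2 == j) (boxes alpha).
  by rewrite -[X in _ <= count _ X](cat_take_drop m) count_cat leq_addr.
by rewrite -[count _ (boxes alpha)]size_filter boxes_row // size_map size_iota.
Qed.

Lemma boxes_prefix_shape m alpha :
  boxes (prefix_shape m alpha) = take m (boxes alpha).
Proof.
apply: (irr_sorted_eq box_lt_trans box_lt_irr); first exact: boxes_sorted.
  exact: take_sorted (boxes_sorted _).
move=> [i j]; rewrite mem_boxes /= size_prefix_shape.
case: (boolP (0 < j <= size alpha)) => hj; last first.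
  transitivity false; first by lia.
  by apply/esym/negP => /mem_take; rewrite mem_boxes /=; lia.
have -> : ((i, j) \in take m (boxes alpha)) =
          ((i, j) \in [seq b <- take m (boxes alpha) | b.2 == j]).
  by rewrite mem_filter eqxx.
rewrite take_boxes_row //; apply/idP/mapP => [H|[a]].
  by exists i => //; rewrite mem_iota; lia.
by rewrite mem_iota => H [->]; lia.
Qed.

Definition two_columns (alpha : seq nat) : nat :=
  column_size 1 alpha + column_size 2 alpha.

Lemma take_two_columns alpha :
  take (two_columns alpha) (boxes alpha) = [seq b <- boxes alpha | b.1 <= 2].
Proof.
rewrite (filter_down_closed box_lt_trans _ (boxes_sorted alpha)); last first.
  by move=> [a b] [c d]; rewrite /box_lt /=; lia.
congr take; rewrite /two_columns /column_size -count_predUI.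
rewrite [X in _ + X](_ : _ = 0) ?addn0; last first.
  apply/eqP; rewrite eqn0Ngt -has_count; apply/hasPn => b _ /=; lia.
by apply: eq_in_count => b; rewrite mem_boxes /=; lia.
Qed.

Lemma mem_take_two_columns alpha m (b : nat * nat) : two_columns alpha <= m ->
  b \in boxes alpha -> b.1 <= 2 -> b \in take m (boxes alpha).
Proof.
move=> hm hb h2; have : b \in take (two_columns alpha) (boxes alpha).
  by rewrite take_two_columns mem_filter h2.
by rewrite -(subnKC hm) takeD mem_cat => ->.
Qed.

Lemma two_columns_leq_size alpha : two_columns alpha <= size (boxes alpha).
Proof.
rewrite /two_columns /column_size -count_predUI.
rewrite [X in _ + X](_ : _ = 0) ?addn0 ?count_size //.
by apply/eqP; rewrite eqn0Ngt -has_count; apply/hasPn => b _ /=; lia.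
Qed.

Lemma nth_boxes_column alpha m : two_columns alpha <= m < size (boxes alpha) ->
  2 < (nth (0, 0) (boxes alpha) m).1.
Proof.
move=> /andP[hm hs]; rewrite ltnNge; apply/negP => h2.
have := mem_take_two_columns hm (mem_nth (0, 0) hs) h2.
rewrite in_take_leq; last exact: ltnW.
by rewrite index_uniq ?boxes_uniq // ltnn.
Qed.

Lemma peak_compositionP alpha :
  reflect (forall j, j < size alpha ->
             0 < nth 0 alpha j /\ (j.+1 < size alpha -> 1 < nth 0 alpha j))
          (peak_composition alpha).
Proof.
apply: (iffP andP) => [[/(all_nthP 0) c /(all_nthP 0) p] j hj|H].
  split=> [|hj1]; first exact: c.
  have := p j; rewrite size_takel ?leq_pred // nth_take; last by lia.
  by apply; lia.
split; apply/(all_nthP 0) => j; first by move=> /H[].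
rewrite size_takel ?leq_pred // => hj; rewrite nth_take //.
by apply: (H j _).2; lia.
Qed.

(** The box in column [minn 2 (nth 0 alpha j)] of the row lies in the first two columns, hence in
    the prefix. This keeps prefix shapes peak compositions and all rows nonempty. *)
Lemma prefix_shape_geq alpha m j : two_columns alpha <= m -> j < size alpha ->
  minn 2 (nth 0 alpha j) <= nth 0 (prefix_shape m alpha) j.
Proof.
move=> hm hj; case: (posnP (minn 2 (nth 0 alpha j))) => [-> //|pos].
have : (minn 2 (nth 0 alpha j), j.+1) \in boxes (prefix_shape m alpha).
  rewrite boxes_prefix_shape; apply: mem_take_two_columns => //=; last by lia.
  by rewrite mem_boxes /=; lia.
by rewrite mem_boxes /=; lia.
Qed.

Lemma peak_prefix_shape alpha m : peak_composition alpha ->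
  two_columns alpha <= m -> peak_composition (prefix_shape m alpha).
Proof.
move=> /peak_compositionP pk hm; apply/peak_compositionP => j.
rewrite size_prefix_shape => hj; have := prefix_shape_geq hm hj.
by have := pk j hj; lia.
Qed.

(** * Restriction of a filling to its first boxes *)

Section Restrict.

Variable T : filling.
Let alpha := shape T.
Hypothesis peak : peak_composition alpha.

(** The filter in [restrict] removes nothing here: every row keeps at least its first box, so row
    indices do not shift. *)
Lemma restrictE m : two_columns alpha <= m ->
  restrict m T = [seq [seq entry T (i, j) |
                        i <- iota 1 (nth 0 (prefix_shape m alpha) j.-1)]
                 | j <- iota 1 (size T)].
Proof.
move=> hm; have sizeT : size alpha = size T by rewrite size_map.
rewrite /restrict.
have -> : [seq [seq entry T b | b <- take m (boxes (shape T)) & b.2 == j]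
            | j <- iota 1 (size T)] = [seq [seq entry T (i, j) |
                        i <- iota 1 (nth 0 (prefix_shape m alpha) j.-1)]
                 | j <- iota 1 (size T)].
  apply/eq_in_map => j; rewrite mem_iota => hj.
  by rewrite take_boxes_row ?sizeT -?map_comp //; lia.
apply/all_filterP/allP => _ /mapP[j + ->]; rewrite mem_iota => hj.
rewrite -size_eq0 size_map size_iota.
have hj1 : j.-1 < size alpha by lia.
have := prefix_shape_geq hm hj1; move/peak_compositionP: peak => /(_ _ hj1); lia.
Qed.

Lemma shape_restrict m : two_columns alpha <= m ->
  shape (restrict m T) = prefix_shape m alpha.
Proof.
move=> hm; rewrite restrictE // /shape -map_comp.
apply: (@eq_from_nth _ 0); rewrite size_map size_iota ?size_prefix_shape ?size_map //.
move=> j hj; rewrite (nth_map 0) ?size_iota // nth_iota // /=.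
by rewrite size_map size_iota.
Qed.

Lemma boxes_restrict m : two_columns alpha <= m ->
  boxes (shape (restrict m T)) = take m (boxes alpha).
Proof. by move=> hm; rewrite shape_restrict // boxes_prefix_shape. Qed.

Lemma entry_restrict m b : two_columns alpha <= m ->
  b \in take m (boxes alpha) -> entry (restrict m T) b = entry T b.
Proof.
case: b => i j hm; rewrite -boxes_prefix_shape mem_boxes /= size_prefix_shape.
rewrite size_map /entry => hb /=.
rewrite restrictE // (nth_map 0) ?size_iota; last by lia.
rewrite nth_iota; last by lia.
rewrite add1n prednK; last by lia.
have hi : i.-1 < nth 0 (prefix_shape m alpha) j.-1 by lia.
rewrite (nth_map 0) ?size_iota // nth_iota // /entry /= add1n prednK //.
Qed.

Lemma column_reading_restrict m : two_columns alpha <= m ->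
  column_reading (restrict m T) = take m (column_reading T).
Proof.
move=> hm; rewrite /column_reading boxes_restrict // -map_take.
by apply/eq_in_map => b hb; exact: entry_restrict.
Qed.

Lemma restrict_restrict m m' : two_columns alpha <= m <= m' ->
  restrict m (restrict m' T) = restrict m T.
Proof.
move=> /andP[hm hm']; rewrite {1 3}/restrict.
have hm2 := leq_trans hm hm'.
have -> : size (restrict m' T) = size T by rewrite restrictE // size_map size_iota.
congr filter; apply/eq_map => j; rewrite boxes_restrict // take_takel //.
apply/eq_in_map => b; rewrite mem_filter => /andP[_ hb].
apply: entry_restrict => //; move: hb.
by rewrite -(subnKC hm') takeD mem_cat => ->.
Qed.

End Restrict.

(** * Fillings, their entries and their rows *)

Lemma eq_filling (T U : filling) : shape T = shape U ->
  {in boxes (shape T), entry T =1 entry U} -> T = U.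
Proof.
move=> eqs eqe; have eqn j : size (nth [::] T j) = size (nth [::] U j).
  have nthS (V : filling) : nth 0 (shape V) j = size (nth [::] V j).
    have [hj|hj] := ltnP j (size V); first by rewrite (nth_map [::]).
    by rewrite !nth_default ?size_map.
  by rewrite -!nthS eqs.
have eqsz : size T = size U by rewrite -(size_map size T) -(size_map size U) [LHS](congr1 size eqs).
apply: (eq_from_nth (x0 := [::])) => // j hj.
apply: (eq_from_nth (x0 := 0)) => // i hi.
have := eqe (i.+1, j.+1); rewrite /entry /=; apply.
by rewrite mem_boxes /= size_map (nth_map [::]) // hj hi.
Qed.

Lemma mem_boxes_shape T (b : nat * nat) :
  (b \in boxes (shape T)) =
  [&& 0 < b.1, 0 < b.2, b.2 <= size T & b.1 <= size (nth [::] T b.2.-1)].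
Proof.
rewrite mem_boxes size_map; case: b => i j /=.
case: (boolP (0 < j <= size T)) => hj; last by lia.
by rewrite (nth_map [::]) //; lia.
Qed.

Lemma perm_column_reading T : perm_eq (column_reading T) (entries T).
Proof.
(* [s] lists the same boxes row by row; reading along it gives [flatten T], and it is a permutation
   of [boxes (shape T)]. *)
pose s := [seq (i, j) | j <- iota 1 (size T),
                        i <- iota 1 (size (nth [::] T j.-1))].
have -> : entries T = [seq entry T b | b <- s].
  rewrite /entries /s map_flatten -map_comp; congr flatten.
  apply: (eq_from_nth (x0 := [::])); rewrite ?size_map ?size_iota // => j hj.
  rewrite (nth_map 0) ?size_iota // nth_iota //= -map_comp.
  apply: (eq_from_nth (x0 := 0)); rewrite ?size_map ?size_iota // => i hi.
  by rewrite (nth_map 0) ?size_iota // nth_iota.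
apply/perm_map/uniq_perm; first exact: boxes_uniq.
  apply: allpairs_uniq_dep; rewrite ?iota_uniq //; first by move=> *; exact: iota_uniq.
  by move=> [j i] [j' i'] _ _ /= [-> ->].
move=> [i j]; rewrite mem_boxes_shape /=; apply/idP/allpairsPdep => [H|].
  by exists j, i; rewrite !mem_iota; split => //; lia.
by move=> [j' [i' []]]; rewrite !mem_iota => H1 H2 [-> ->]; lia.
Qed.

Lemma mem_column_reading T : column_reading T =i entries T.
Proof. exact/perm_mem/perm_column_reading. Qed.

Lemma entriesP T a :
  reflect (exists2 b, b \in boxes (shape T) & a = entry T b) (a \in entries T).
Proof. by rewrite -mem_column_reading; apply: mapP. Qed.

Lemma mem_entry T b : b \in boxes (shape T) -> entry T b \in entries T.
Proof. by move=> hb; apply/entriesP; exists b. Qed.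

Lemma uniq_column_reading T : uniq (column_reading T) = uniq (entries T).
Proof. exact/perm_uniq/perm_column_reading. Qed.

Lemma entry_inj T : uniq (entries T) ->
  {in boxes (shape T) &, injective (entry T)}.
Proof.
rewrite -uniq_column_reading => un b b' hb hb' eqe.
have hi c : c \in boxes (shape T) -> index c (boxes (shape T)) < size (column_reading T).
  by rewrite size_map index_mem.
have nE c : c \in boxes (shape T) ->
  nth 0 (column_reading T) (index c (boxes (shape T))) = entry T c.
  by move=> hc; rewrite (nth_map (0, 0)) ?index_mem // nth_index.
have := nth_uniq 0 (hi b hb) (hi b' hb') un.
rewrite !nE // eqe eqxx => /esym/eqP/(congr1 (nth (0, 0) (boxes (shape T)))).
by rewrite !nth_index.
Qed.

Lemma index_entry T (b : nat * nat) : uniq (entries T) -> b \in boxes (shape T) ->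
  index (entry T b) (column_reading T) = index b (boxes (shape T)).
Proof.
move=> un; rewrite /column_reading.
(* The induction runs over a sublist, while injectivity of [entry] stays stated for the full list of
   boxes. *)
have : {subset boxes (shape T) <= boxes (shape T)} by [].
move: (entry_inj un) => inj.
elim: {1 3 4 5}(boxes (shape T)) => //= c s IH sub; rewrite inE.
have hc : c \in boxes (shape T) by apply: sub; rewrite mem_head.
case: (eqVneq b c) => [-> _|ne /= hb]; first by rewrite ?eqxx.
have hb' : b \in boxes (shape T) by apply: sub; rewrite inE hb orbT.
rewrite (inj_in_eq inj) // [c == b]eq_sym (negbTE ne) IH // => d ds.
by apply: sub; rewrite inE ds orbT.
Qed.

Lemma nth_uniq_flatten (T : filling) j k a : uniq (flatten T) ->
  a \in nth [::] T j -> a \in nth [::] T k -> j = k.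
Proof.
elim: T j k => [|r T IH] [|j] [|k] //=; rewrite cat_uniq.
- move=> /and3P[_ /hasPn dis _] ar aT; have /dis : a \in flatten T.
    have hk : k < size T by case: ltnP aT => // hk; rewrite nth_default.
    by apply/flattenP; exists (nth [::] T k); rewrite ?mem_nth.
  by rewrite /= ar.
- move=> /and3P[_ /hasPn dis _] aT ar; have /dis : a \in flatten T.
    have hk : j < size T by case: ltnP aT => // hk; rewrite nth_default.
    by apply/flattenP; exists (nth [::] T j); rewrite ?mem_nth.
  by rewrite /= ar.
by move=> /and3P[_ _ un] h1 h2; rewrite (IH j k).
Qed.

Lemma row_of_entry T (b : nat * nat) : uniq (entries T) -> b \in boxes (shape T) ->
  row_of T (entry T b) = b.2.-1.
Proof.
move=> un; rewrite mem_boxes_shape => /and4P[b1 b2 le2 le1].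
have hr : entry T b \in nth [::] T b.2.-1 by rewrite mem_nth // prednK.
have hT : nth [::] T b.2.-1 \in T by rewrite mem_nth // prednK.
have hs : has (fun r => entry T b \in r) T by apply/hasP; exists (nth [::] T b.2.-1).
exact: nth_uniq_flatten un (nth_find [::] hs) hr.
Qed.

Lemma shape_map (f : nat -> nat) T : shape (map (map f) T) = shape T.
Proof. by rewrite /shape -map_comp; apply: eq_map => r /=; rewrite size_map. Qed.

Lemma entry_map (f : nat -> nat) T (b : nat * nat) : b \in boxes (shape T) ->
  entry (map (map f) T) b = f (entry T b).
Proof.
rewrite mem_boxes_shape => /and4P[b1 b2 le2 le1].
by rewrite /entry (nth_map [::]) ?(nth_map 0) ?prednK.
Qed.

(** * Exchanging two consecutive entries *)

Definition swap i a : nat := if a == i then i.+1 else if a == i.+1 then i else a.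

Lemma swapK i : involutive (swap i).
Proof. by move=> a; rewrite /swap; do ![case: eqP => //]; lia. Qed.

Lemma swap_inj i : injective (swap i). Proof. exact: inv_inj (swapK i). Qed.

Lemma shape_swap i T : shape (swap_entries i T) = shape T.
Proof. exact: shape_map. Qed.

Lemma entry_swap i T b : b \in boxes (shape T) ->
  entry (swap_entries i T) b = swap i (entry T b).
Proof. exact: entry_map. Qed.

Lemma entries_swap i T : entries (swap_entries i T) = map (swap i) (entries T).
Proof. by rewrite /entries map_flatten. Qed.

Lemma perm_entries_swap i T : uniq (entries T) ->
  i \in entries T -> i.+1 \in entries T ->
  perm_eq (entries (swap_entries i T)) (entries T).
Proof.
move=> un hi hi1; apply: uniq_perm => //.
  by rewrite entries_swap (map_inj_uniq (@swap_inj i)).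
move=> a; rewrite entries_swap -{1}(swapK i a) (mem_map (@swap_inj i)) /swap.
by case: eqP => [->|_]; [rewrite hi hi1 | case: eqP => [->|//]; rewrite hi hi1].
Qed.

Lemma swap_entriesK i : involutive (swap_entries i).
Proof.
move=> T; apply: eq_filling; rewrite !shape_swap // => b hb.
by rewrite !entry_swap ?shape_swap // swapK.
Qed.

Lemma row_of_swap i T a : row_of (swap_entries i T) a = row_of T (swap i a).
Proof.
rewrite /row_of find_map; apply: eq_find => r /=.
by rewrite -{1}(swapK i a) (mem_map (@swap_inj i)).
Qed.

(** * Increasing rows, the row reading, and SPITs by inequalities *)

Lemma rows_increaseP T :
  reflect (rows_increase T) (all (sorted ltn) T).
Proof.
apply: (iffP (all_nthP [::])) => [H i j i0|H j hj].
  rewrite mem_boxes_shape /= => hb.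
  have := H j.-1; rewrite /entry /= => /(_ ltac:(lia))/(sortedP 0)/(_ i.-1).
  by rewrite prednK //; apply; lia.
apply/(sortedP 0) => i hi; have := H i.+1 j.+1 isT.
by rewrite /entry /=; apply; rewrite mem_boxes_shape /=; lia.
Qed.

(** Upper rows are read first, which settles the case of two rows. In a common row the smaller [a]
    is read first, and both sides are false. *)
Lemma index_row_reading T a a' : all (sorted ltn) T -> uniq (entries T) ->
  a \in entries T -> a' \in entries T -> a < a' ->
  (index a' (row_reading T) < index a (row_reading T)) =
  (row_of T a < row_of T a').
Proof.
rewrite /row_reading /entries /row_of.
elim: T => [|r T IH] //= /andP[sr sT]; rewrite cat_uniq => /and3P[ur dis un].
rewrite rev_cons -cats1 flatten_cat /= cats0 !index_cat !mem_cat.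
have mem_rev x : (x \in flatten (rev T)) = (x \in flatten T).
  by apply/flattenP/flattenP => -[s + xs]; rewrite ?mem_rev => sT'; exists s; rewrite ?mem_rev.
have notr x : x \in flatten T -> x \in r = false.
  by move=> xT; apply: contraNF dis => xr; apply/hasP; exists x.
rewrite !mem_rev; case: (boolP (a \in flatten T)) => aT; case: (boolP (a' \in flatten T)) => a'T.
- by move=> _ _ lt; rewrite (notr a) // (notr a') //= IH.
- move=> _; rewrite (notr a) // => /orP[ar' _|//]; rewrite ar' /=; apply/negbTE.
  by rewrite -leqNgt (leq_trans _ (leq_addr _ _)) // ltnW // index_mem mem_rev.
- move=> /orP[ar _ _|//]; rewrite ar (notr a') //=.
  by rewrite (leq_trans _ (leq_addr _ _)) // index_mem mem_rev.
move=> /orP[ar|//] /orP[a'r|//] lt; rewrite ar a'r /= ltn_add2l.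
apply/negbTE; rewrite -leqNgt leqNgt; apply/negP.
by move/(sorted_ltn_index ltn_trans sr _ _ a'r ar); lia.
Qed.

Lemma sorted_leq_count (s : seq nat) k i : sorted ltn s -> i < size s ->
  (nth 0 s i <= k) = (i < count (fun a => a <= k) s).
Proof.
move=> ss hi; transitivity (nth 0 s i \in [seq a <- s | a <= k]).
  by rewrite mem_filter mem_nth ?andbT.
rewrite (filter_down_closed ltn_trans _ ss); last by move=> x y /=; lia.
by rewrite in_take_leq ?count_size // index_uniq // (sorted_uniq ltn_trans ltnn).
Qed.

(** Chain the inequalities from the head of a row to its second entry and on to the head of the next
    row: the first two columns increase row by row. *)
Lemma two_columns_lt T (b : nat * nat) (j : nat) : peak_composition (shape T) -> rows_increase T ->
  peaks_increase T -> b \in boxes (shape T) -> b.1 <= 2 -> b.2 < j ->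
  (1, j) \in boxes (shape T) -> entry T b < entry T (1, j).
Proof.
case: b => i j0 /= /peak_compositionP pk ri pi hb hi.
have below j' : 0 < j' -> (1, j'.+1) \in boxes (shape T) -> (2, j') \in boxes (shape T).
  rewrite !mem_boxes /= => j'0 h; have := pk j'.-1; lia.
elim: j => [//|j IH]; rewrite ltnS leq_eqVlt => /predU1P[<-|lt] hj.
  have j00 : 0 < j0 by move: hb; rewrite mem_boxes /=; lia.
  apply: leq_ltn_trans (pi j0 j00 hj).
  have [->|->] : i = 1 \/ i = 2 by move: hb; rewrite mem_boxes /=; lia.
    by apply/ltnW/ri => //; exact: below.
  by [].
have j00 : 0 < j by lia.
have h2 := below _ j00 hj.
have h1 : (1, j) \in boxes (shape T) by move: h2; rewrite !mem_boxes /=; lia.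
apply: ltn_trans (IH lt h1) _; apply: ltn_trans (pi j j00 hj).
exact: ri.
Qed.

(** The condition for all [k] collapses to local inequalities. One direction takes [k] to be the
    head of a row; in the other, the entries up to [k] fill an initial segment of each row and meet
    an initial set of rows, all but the last of which contain their second box. *)
Lemma SPITP alpha T : peak_composition alpha ->
  SPIT alpha T <->
  [/\ shape T = alpha, perm_eq (entries T) (iota 1 (sumn alpha)),
      rows_increase T & peaks_increase T].
Proof.
move=> pk; split=> [[[sh pe /rows_increaseP ri _] H]|[sh pe ri pi]].
  split=> // j j0 hj.
  have un : uniq (entries T) by rewrite (perm_uniq pe) iota_uniq.
  have : entry T (1, j.+1) \in iota 1 (sumn alpha).
    by rewrite -(perm_mem pe) mem_entry.
  (* For this [k] row [j] is not the last row of [beta], so it has a second box there, whose entry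
     is at most [k]. *)
  rewrite mem_iota => hk; have [|beta pkb eqb] := H (entry T (1, j.+1)); first by lia.
  have := eqb (1, j.+1); rewrite mem_filter leqnn -sh hj => /esym.
  have := peak_compositionP _ pkb j.-1.
  rewrite mem_boxes /= => pkj hj2.
  have := eqb (2, j); rewrite mem_filter [X in _ = X]mem_boxes /=.
  have -> : [&& 0 < j, j <= size beta & 1 < nth 0 beta j.-1] by lia.
  move=> /andP[le hb]; rewrite ltn_neqAle le andbT.
  by apply/eqP => /(entry_inj un (_ : _ \in _) hj); rewrite sh => /(_ hb).
have un : uniq (entries T) by rewrite (perm_uniq pe) iota_uniq.
have pkT : peak_composition (shape T) by rewrite sh.
have head j : 0 < j <= size T -> (1, j) \in boxes (shape T).
  move=> hj; rewrite mem_boxes /= size_map.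
  by move/peak_compositionP: pkT => /(_ j.-1); rewrite size_map; lia.
have srt := introT (rows_increaseP T) ri.
split; first split => //.
  rewrite /first_column sorted_map.
  set s := [seq b <- _ | _].
  have ss : sorted box_lt s := (sorted_filter box_lt_trans) _ _ (boxes_sorted _).
  apply: (sub_in_sorted (P := mem s)) ss; last exact/allP.
  move=> [a b] [c d] h1 h2; have : (c, d) \in s := h2; have : (a, b) \in s := h1.
  rewrite mem_filter /= => /andP[/eqP -> {}h1].
  rewrite mem_filter /= => /andP[/eqP -> {}h2].
   by rewrite /box_lt /= => lt; apply: two_columns_lt.
move=> k hk.
pose heads := [seq entry T (1, j) | j <- iota 1 (size T)].
have nth_heads j : 0 < j <= size T -> nth 0 heads j.-1 = entry T (1, j).
  move=> hj; rewrite (nth_map 0) ?size_iota ?nth_iota; try lia.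
  by rewrite add1n prednK //; lia.
have sh1 : sorted ltn heads.
  rewrite sorted_map.
  apply: (sub_in_sorted (P := mem (iota 1 (size T)))) (iota_ltn_sorted _ _).
    move=> a b ha hb lt; have : b \in iota 1 (size T) := hb.
    have : a \in iota 1 (size T) := ha.
    by rewrite !mem_iota => {}ha {}hb; apply: two_columns_lt => //; apply: head; lia.
  exact/allP.
have szh : size heads = size T by rewrite size_map size_iota.
(* [N] counts the rows already started by the entries up to [k], and [c] counts these entries row by
   row; cutting [c] after [N] parts gives the required peak composition. *)
pose N := count (fun a => a <= k) heads.
pose c := [seq count (fun a => a <= k) r | r <- T].
have NT : N <= size T by rewrite -szh count_size.
have headN j : 0 < j <= size T -> (entry T (1, j) <= k) = (j <= N).
  move=> hj; rewrite -nth_heads // sorted_leq_count //; last by rewrite szh; lia.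
  by rewrite prednK //; lia.
have boxc i j : (i, j) \in boxes (shape T) ->
   (entry T (i, j) <= k) = (i <= nth 0 c j.-1).
  rewrite mem_boxes_shape /= => /and4P[b1 b2 le2 le1].
  rewrite /entry sorted_leq_count ?prednK //=; last first.
    by apply: (all_nthP [::] srt); rewrite prednK.
  by rewrite /c (nth_map [::]) ?prednK.
have cle j : nth 0 c j <= nth 0 (shape T) j.
  have [hj|hj] := ltnP j (size T); last by rewrite !nth_default ?size_map.
  by rewrite !(nth_map [::]) // count_size.
have szc : size (take N c) = N by rewrite size_takel // size_map.
exists (take N c).
  apply/peak_compositionP => j; rewrite szc => hj; rewrite nth_take //.
  have hb : (1, j.+1) \in boxes (shape T) by apply: head; lia.
  have := boxc _ _ hb; rewrite headN; last by lia.
  rewrite hj /= => /esym h0; split=> // hj1.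
  have hb2 : (1, j.+2) \in boxes (shape T) by apply: head; lia.
  have h2 : (2, j.+1) \in boxes (shape T).
    move/peak_compositionP: pkT => /(_ j); move: hb hb2.
    by rewrite !mem_boxes /=; lia.
  have := boxc _ _ h2; rewrite /= => <-.
  apply: leq_trans (ltnW (pi j.+1 isT hb2)) _.
  by rewrite headN //; lia.
move=> [i j]; rewrite mem_filter [X in _ = X]mem_boxes szc -sh.
apply/andP/idP => [[le hb]|].
  have := hb; rewrite mem_boxes_shape => /and4P[/= b1 b2 le2 le1].
  have jN : j <= N.
    rewrite -headN ?b2 //; apply: leq_trans le; have : (1, j) \in boxes (shape T).
      by apply: head; lia.
    case: i b1 le1 hb => [//|[//|i]] _ _ hb hb1.
    elim: i hb => [|i IH] hb.
      by apply/ltnW/ri.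
    apply: leq_trans (IH _) (ltnW (ri i.+2 j isT hb)).
    by move: hb; rewrite !mem_boxes /=; lia.
  by rewrite b1 b2 jN nth_take ?prednK //= -boxc.
move=> /and4P[/= b1 b2 jN]; rewrite nth_take ?prednK // => le.
have hb : (i, j) \in boxes (shape T).
  by rewrite mem_boxes /= size_map; have := cle j.-1; lia.
by rewrite boxc.
Qed.

(** Standardization is strictly increasing on the entries, so the inequalities of [SPITP] pass to
    the standardized filling. *)
Lemma generalized_SPITP T : peak_composition (shape T) -> uniq (entries T) ->
  all (leq 1) (entries T) -> rows_increase T -> peaks_increase T ->
  generalized_SPIT (shape T) T.
Proof.
move=> pk un pos ri pi; split=> //.
pose s := sort leq (entries T); pose f a := (index a s).+1.
have ss : sorted leq s by apply: sort_sorted; exact: leq_total.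
have us : uniq s by rewrite sort_uniq.
have mono b b' : b \in boxes (shape T) -> b' \in boxes (shape T) ->
    entry T b < entry T b' ->
    entry (map (map f) T) b < entry (map (map f) T) b'.
  move=> hb hb' lt; rewrite !entry_map // ltnS ltnNge; apply/negP => le.
  have := sorted_leq_index leq_trans leqnn ss _ _ _ _ le.
  by rewrite !mem_sort !mem_entry // => /(_ isT isT); rewrite leqNgt lt.
apply/SPITP => //; split; first exact: shape_map.
- have -> : entries (standardize T) = map f (entries T) by rewrite /entries map_flatten.
  rewrite -size_flatten.
  (* On the sorted list of entries [f] returns position plus one. *)
  suff <- : map f s = iota 1 (size (flatten T)).
    by apply: perm_map; rewrite perm_sym perm_sort.
  apply: (eq_from_nth (x0 := 0)); rewrite size_map size_sort ?size_iota // => i hi.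
  by rewrite (nth_map 0) ?size_sort // nth_iota // /f index_uniq ?size_sort.
- move=> i j i0; rewrite shape_map => hb; apply: mono => //; last exact: ri.
  by move: hb; rewrite !mem_boxes /=; lia.
move=> j j0; rewrite shape_map => hb; apply: mono => //; last exact: pi.
move/peak_compositionP: pk => /(_ j.-1); move: hb; rewrite !mem_boxes /=; lia.
Qed.

(** * Descents of the row reading in terms of rows *)

Lemma swap_ltn i a a' : a < a' -> ~~ ((a == i) && (a' == i.+1)) ->
  swap i a < swap i a'.
Proof. by rewrite /swap; do ?[case: eqP => /= ?]; lia. Qed.

Lemma mem_row_reading T : row_reading T =i entries T.
Proof.
move=> a; apply/flattenP/flattenP => -[r + ar].
  by rewrite mem_rev => rT; exists r.
by move=> rT; exists r; rewrite ?mem_rev.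
Qed.

Lemma Asc_not_lt w i :
  Asc w i = [&& i \in w, i.+1 \in w & ~~ (index i.+1 w < index i w)].
Proof.
rewrite /Asc; case: (boolP (i \in w)) => //= hi; case: (boolP (i.+1 \in w)) => //= hi1.
suff : index i w != index i.+1 w by lia.
by apply/eqP => /(congr1 (nth 0 w)); rewrite !nth_index //; lia.
Qed.

Lemma Des_row_reading V i : rows_increase V -> uniq (entries V) ->
  Des (row_reading V) i =
  [&& i \in entries V, i.+1 \in entries V & row_of V i < row_of V i.+1].
Proof.
move=> ri un; rewrite /Des !mem_row_reading.
case: (boolP (i \in _)) => //= hi; case: (boolP (i.+1 \in _)) => //= hi1.
by rewrite index_row_reading //; apply/rows_increaseP.
Qed.

Lemma Asc_row_reading V i : rows_increase V -> uniq (entries V) ->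
  Asc (row_reading V) i =
  [&& i \in entries V, i.+1 \in entries V & row_of V i.+1 <= row_of V i].
Proof.
move=> ri un; rewrite Asc_not_lt !mem_row_reading.
case: (boolP (i \in _)) => //= hi; case: (boolP (i.+1 \in _)) => //= hi1.
by rewrite index_row_reading -?leqNgt //; apply/rows_increaseP.
Qed.

(* [lia] is very slow in the presence of membership hypotheses. *)
Ltac slim_lia :=
  repeat match goal with
  | H : is_true (_ \in _) |- _ => clear H
  | H : is_true (~~ (_ \in _)) |- _ => clear H
  | H : is_true (uniq _) |- _ => clear H
  | H : is_true (perm_eq _ _) |- _ => clear H
  | H : is_true (peak_composition _) |- _ => clear H
  | A := _ : bool |- _ => clearbody A
  end; lia.

(** * Recovering the start of a walk from its end *)

(* The Algorithm moved the entry of the new box, in row [y], from [h] to [z];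
   [S] and [r] are the entries and the row function of the final filling. *)
Inductive trace (S : seq nat) (r : nat -> nat) (y h z : nat) : Prop :=
| Trace_stay of z = h & ~ (h.-1 \in S /\ r h.-1 < y) &
    ~ (h.+1 \in S /\ r h.+1 < y)
| Trace_down of z < h & (forall v, z < v <= h -> v \in S /\ r v < y) &
    (forall v, z < v < h -> r v.+1 <= r v) &
    ~ [/\ z.-1 \in S, r z.-1 < y & r z.+1 <= r z.-1] &
    ~ [/\ h.+1 \in S, r h.+1 < y & r h.+1 <= r h]
| Trace_up of h < z & (forall v, h <= v < z -> v \in S /\ r v < y) &
    (forall v, h <= v -> v.+1 < z -> r v < r v.+1) &
    ~ [/\ z.+1 \in S, r z.+1 < y & r z.-1 < r z.+1] &
    ~ [/\ h.-1 \in S, r h.-1 < y & r h.-1 < r h].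

(** Two walks in the same direction cannot have different starts: the longer one passes the nearer
    start with exactly the row comparison that the last clause of the shorter trace forbids. A walk
    that stayed has no neighbour of [z] in a lower row, whereas one that moved left such a neighbour
    behind. *)
Lemma trace_inj S r y z h h' : trace S r y h z -> trace S r y h' z -> h = h'.
Proof.
move=> [eq1 n1 p1|lt1 S1 m1 e1 s1|lt1 S1 m1 e1 s1]
       [eq2 n2 p2|lt2 S2 m2 e2 s2|lt2 S2 m2 e2 s2].
- by rewrite -eq1.
- by subst h; case: p1; apply: S2; lia.
- by subst h; case: n1; apply: S2; lia.
- by subst h'; case: p2; apply: S1; lia.
- case: (ltngtP h h') => // lt.
  + have [hS hr] := S2 h.+1 ltac:(lia).
    by case: s1; split=> //; apply: m2; lia.
  + have [hS hr] := S1 h'.+1 ltac:(lia).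
    by case: s2; split=> //; apply: m1; lia.
(* Opposite directions put both neighbours of [z] in rows below [y]. Comparing their rows then
   contradicts the stopping clause of one of the two walks. *)
- have [pS pr] := S1 z.+1 ltac:(lia); have [qS qr] := S2 z.-1 ltac:(lia).
  by case: (leqP (r z.+1) (r z.-1)) => ?; [case: e1|case: e2].
- by subst h'; case: n2; apply: S1; lia.
- have [pS pr] := S2 z.+1 ltac:(lia); have [qS qr] := S1 z.-1 ltac:(lia).
  by case: (leqP (r z.+1) (r z.-1)) => ?; [case: e2|case: e1].
case: (ltngtP h h') => // lt.
  have [hS hr] := S1 h'.-1 ltac:(lia); case: s2; split=> //.
  by have := m1 h'.-1; rewrite prednK; [apply|]; lia.
have [hS hr] := S2 h.-1 ltac:(lia); case: s1; split=> //.
by have := m2 h.-1; rewrite prednK; [apply|]; lia.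
Qed.

Lemma rows_increase_leq V (i i' j : nat) : rows_increase V -> 0 < i <= i' ->
  (i', j) \in boxes (shape V) -> entry V (i, j) <= entry V (i', j).
Proof.
move=> ri; elim: i' => [|i' IH] hi hb'; first by lia.
case: (eqVneq i i'.+1) => [-> //|ne].
have hb'' : (i', j) \in boxes (shape V) by move: hb'; rewrite !mem_boxes /=; lia.
by apply: leq_trans (IH _ hb'') (ltnW (ri _ _ _ hb')); lia.
Qed.

Definition swaps (s : seq nat) (V : filling) : filling :=
  foldl (fun V i => swap_entries i V) V s.

Lemma swaps_rcons s i V : swaps (rcons s i) V = swap_entries i (swaps s V).
Proof. exact: foldl_rcons. Qed.

(** Undoes a walk from [h] to [z], last swap first: the indices are [z], ..., [h - 1] after a
    downward walk and [z - 1], ..., [h] after an upward one. The result depends only on [z], [h] and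
    the final filling. *)
Definition unwind z h : filling -> filling :=
  swaps (if z <= h then iota z (h - z) else rev (iota h (z - h))).

(** * One run of the Algorithm as a walk of the new entry *)

Section Loop.

Variables (T : filling) (b : nat * nat).
Let S := entries T.
Let w := column_reading T.
Let y := b.2.-1.
Let tgt i := index i.+1 w < index i w.

Hypotheses (peak : peak_composition (shape T)) (unS : uniq S) (S0 : 0 \notin S).
Hypotheses (hb : b \in boxes (shape T)) (hb2 : 2 < b.1).

(* [conf_barrier] says that no entry has crossed a value absent from [T]. *)
Record conf (V : filling) (z : nat) : Prop := Conf {
  conf_shape : shape V = shape T;
  conf_perm : perm_eq (entries V) S;
  conf_rows : rows_increase V;
  conf_peaks : peaks_increase V;
  conf_entry : entry V b = z;
  conf_barrier : forall b' v, b' \in boxes (shape T) -> v \notin S ->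
    (entry V b' < v) = (entry T b' < v) }.

(** For a filling satisfying [conf], this says that [i] is in neither of the two sets of Step 2. *)
Definition good V i := i \in S -> i.+1 \in S ->
  (row_of V i < row_of V i.+1) = tgt i.

Lemma conf_uniq V z : conf V z -> uniq (entries V).
Proof. by case=> _ /perm_uniq ->. Qed.

Lemma conf_mem V z : conf V z -> z \in S.
Proof. by case=> sh pe _ _ <- _; rewrite -(perm_mem pe) mem_entry // sh. Qed.

Lemma conf_row V z : conf V z -> row_of V z = y.
Proof. by move=> cV; rewrite -(conf_entry cV) row_of_entry ?(conf_uniq cV) // (conf_shape cV). Qed.

(** The swap reverses only the comparison of [i] with [i.+1]. These lie in different rows, so rows
    stay increasing; one of them is in [b], beyond column 2, so the peak inequalities survive. An
    absent value is neither of the two, so nothing crosses it. *)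
Lemma conf_swap V z i : conf V z -> i \in S -> i.+1 \in S ->
  row_of V i != row_of V i.+1 -> (z == i) || (z == i.+1) ->
  conf (swap_entries i V) (swap i z).
Proof.
move=> cV iS i1S rne hz; have [sh pe ri pi ze ba] := cV; have un := conf_uniq cV.
have mem := perm_mem pe.
split.
- by rewrite shape_swap.
- by apply: perm_trans pe; apply: perm_entries_swap; rewrite ?mem.
- move=> c j c0; rewrite shape_swap => hc.
  have hc' : (c, j) \in boxes (shape V) by move: hc; rewrite !mem_boxes /=; slim_lia.
  rewrite !entry_swap //; apply: swap_ltn; first exact: ri.
  apply: contra rne => /andP[/eqP <- /eqP <-].
  by rewrite !row_of_entry.
- move=> j j0; rewrite shape_swap => hj.
  have hj' : (2, j) \in boxes (shape V).
    move: hj; rewrite !mem_boxes sh /=.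
    by move/peak_compositionP: peak => /(_ j.-1); slim_lia.
  rewrite !entry_swap //; apply: swap_ltn; first exact: pi.
  apply/negP => /andP[/eqP e1 /eqP e2].
  have hbV : b \in boxes (shape V) by rewrite sh.
  case/orP: hz => /eqP hz.
    have eb : b = (2, j) by apply: (entry_inj un) => //; rewrite ze hz e1.
    by move: hb2; rewrite eb.
  have eb : b = (1, j.+1) by apply: (entry_inj un) => //; rewrite ze hz e2.
  by move: hb2; rewrite eb.
- by rewrite entry_swap ?sh // ze.
move=> b' v hb' vS; rewrite entry_swap ?sh // -ba //.
have vi : v <> i by move=> e; rewrite e iS in vS.
have vi1 : v <> i.+1 by move=> e; rewrite e i1S in vS.
by rewrite /swap; do ?[case: eqP => ?]; slim_lia.
Qed.

Lemma setAE V z i : conf V z -> setA T V i =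
  [&& i \in S, i.+1 \in S, row_of V i < row_of V i.+1 & ~~ tgt i].
Proof.
move=> cV; rewrite /setA /= Des_row_reading ?(conf_uniq cV) //; last exact: conf_rows cV.
rewrite Asc_not_lt !(perm_mem (conf_perm cV)) !mem_column_reading -/S -/w /tgt.
by case: (i \in S); case: (i.+1 \in S).
Qed.

Lemma setBE V z i : conf V z -> setB T V i =
  [&& i \in S, i.+1 \in S, row_of V i.+1 <= row_of V i & tgt i].
Proof.
move=> cV; rewrite /setB /= Asc_row_reading ?(conf_uniq cV) //; last exact: conf_rows cV.
rewrite /Des !(perm_mem (conf_perm cV)) !mem_column_reading -/S -/w /tgt.
by case: (i \in S); case: (i.+1 \in S).
Qed.

Lemma setA_good V z i : conf V z -> good V i -> setA T V i = false.
Proof.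
move=> cV; rewrite (setAE _ cV) /good.
by case: (i \in S) => //; case: (i.+1 \in S) => // /(_ isT isT) ->; rewrite andbN.
Qed.

Lemma setB_good V z i : conf V z -> good V i -> setB T V i = false.
Proof.
move=> cV; rewrite (setBE _ cV) /good [row_of V i.+1 <= _]leqNgt.
by case: (i \in S) => //; case: (i.+1 \in S) => // /(_ isT isT) ->; rewrite andNb.
Qed.

Lemma stop_good V z : conf V z -> (forall i, good V i) -> loop_returns T V V.
Proof.
by move=> cV gV; apply: Loop_stop => i; [apply: setA_good cV _|apply: setB_good cV _].
Qed.

Lemma step_A V z i : conf V z -> (forall j, j != i -> good V j) ->
  i \in S -> i.+1 \in S -> row_of V i < row_of V i.+1 -> ~~ tgt i ->
  swap_index T V i.
Proof.
move=> cV gV iS i1S ri ti; apply: Swap_A => j; case: (eqVneq j i) => [->|ne] /=.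
- by rewrite (setAE _ cV) iS i1S ri ti eqxx.
- by rewrite (setA_good cV) ?(negbTE ne) //; exact: gV.
- by rewrite (setBE _ cV) (negbTE ti) !andbF.
by rewrite (setB_good cV) //; exact: gV.
Qed.

Lemma step_B V z i : conf V z -> (forall j, j != i -> good V j) ->
  i \in S -> i.+1 \in S -> row_of V i.+1 <= row_of V i -> tgt i ->
  swap_index T V i.
Proof.
move=> cV gV iS i1S ri ti; apply: Swap_B => j; case: (eqVneq j i) => [->|ne] /=.
- by rewrite (setAE _ cV) ti !andbF.
- by rewrite (setA_good cV) //; exact: gV.
- by rewrite (setBE _ cV) iS i1S ri ti eqxx.
by rewrite (setB_good cV) ?(negbTE ne) //; exact: gV.
Qed.

Lemma conf_pos V z : conf V z -> 0 < z.
Proof. by move=> /conf_mem zS; case: z zS => //; rewrite (negPf S0). Qed.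

Lemma row_of_swapL i V : row_of (swap_entries i V) i = row_of V i.+1.
Proof. by rewrite row_of_swap /swap eqxx. Qed.

Lemma row_of_swapR i V : row_of (swap_entries i V) i.+1 = row_of V i.
Proof. by rewrite row_of_swap /swap eqxx; case: eqP => //; slim_lia. Qed.

Lemma row_of_swapD i V a : a != i -> a != i.+1 ->
  row_of (swap_entries i V) a = row_of V a.
Proof. by rewrite row_of_swap /swap => /negbTE -> /negbTE ->. Qed.

(** Continues a walk whose last step was downward, so that [z.+1] is the entry just passed. Only
    index [z.-1] may still be wrong; its target was correct before that step and therefore compares
    the rows of [z.-1] and [z.+1]. Each step decreases [z], which gives the induction. *)
Lemma down_loop z V : conf V z -> z.+1 \in S -> row_of V z.+1 < y ->
  (forall i, i.+1 != z -> good V i) ->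
  (forall i, i.+1 = z -> i \in S -> tgt i = (row_of V i < row_of V z.+1)) ->
  exists W z', [/\ loop_returns T V W, conf W z', forall i, good W i, z' <= z
                 & V = swaps (iota z' (z - z')) W] /\
    [/\ forall v, z < v -> row_of W v = row_of V v,
        forall v, z' < v <= z.+1 -> v \in S /\ row_of W v < y,
        forall v, z' < v <= z -> row_of W v.+1 <= row_of W v
      & ~ [/\ z'.-1 \in S, row_of W z'.-1 < y & row_of W z'.+1 <= row_of W z'.-1]].
Proof.
elim: z V => [|k IH] V cV z1S r1 gV tV; first by have := conf_pos cV.
have kz := conf_row cV; have k1S := conf_mem cV.
case: (boolP [&& k \in S, row_of V k < y & row_of V k.+2 <= row_of V k]); last first.
  move=> stop; exists V, k.+1; split; last first.
    split=> // [v hv|v hv|[kS ky k2]].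
    - by have -> : v = k.+2 by slim_lia.
    - by slim_lia.
    by move: stop; rewrite kS ky k2.
  (* The entry passed lies below row [y]. If [k] is not below [y], the descent is neither present
     nor wanted; if it is, failure to continue means that it is wanted. *)
  have gV' i : good V i.
    case: (eqVneq i.+1 k.+1) => [[->]|/gV //] kS _.
    rewrite kz tV //; move: stop; rewrite kS /=; case: leqP => /=; slim_lia.
  split=> //; first exact: stop_good cV gV'.
  by rewrite subnn.
move=> /and3P[kS ky k2]; have tk : ~~ tgt k by rewrite tV //; slim_lia.
(* After the swap index [k.+1] compares the former row of [k] with that of [k.+2]; as [k2] holds, it
   remains a non-descent, as wanted. *)
have tk1 : tgt k.+1 = false by rewrite -gV // ?kz; slim_lia.
have sw : swap_index T V k.
  by apply: (step_A cV) => //; rewrite kz.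
have cV' : conf (swap_entries k V) k.
  have e : swap k k.+1 = k by rewrite /swap; do ?[case: eqP => ?]; slim_lia.
  by rewrite -[X in conf _ X]e; apply: conf_swap => //; rewrite ?eqxx ?orbT // kz; slim_lia.
have [||i hi|i hi iS|W [z' [[lW cW gW zk eV] [rW S1 m1 e1]]]] := IH _ cV'.
- exact: k1S.
- by rewrite row_of_swapR.
- move=> iS i1S; case: (eqVneq i k) => [ik|nk].
    rewrite ik row_of_swapL row_of_swapR kz (negbTE tk); slim_lia.
  case: (eqVneq i k.+1) => [ik|nk1].
    rewrite ik row_of_swapR row_of_swapD ?tk1; slim_lia.
  by rewrite !row_of_swapD; try slim_lia; apply: gV => //; slim_lia.
- by rewrite row_of_swapR row_of_swapD -?gV ?hi //; slim_lia.
exists W, z'; split; split=> //.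
- exact: Loop_step sw lW.
- exact: leqW.
- by rewrite subSn // -addn1 iotaD cats1 swaps_rcons -eV subnKC // swap_entriesK.
- by move=> v hv; rewrite rW ?row_of_swapD; slim_lia.
- move=> v hv; case: (eqVneq v k.+2) => [->|nv]; last by apply: S1; slim_lia.
  by rewrite rW ?row_of_swapD //; slim_lia.
move=> v hv; case: (eqVneq v k.+1) => [->|nv]; last by apply: m1; slim_lia.
by rewrite !rW // row_of_swapR row_of_swapD //; slim_lia.
Qed.

Hypothesis last_box : (b.1.+1, b.2) \notin boxes (shape T).

(** The box [b] ends its row and rows increase, so no entry of that row exceeds the one in [b]. *)
Lemma conf_row_neq V z v : conf V z -> v \in S -> z < v -> row_of V v != y.
Proof.
move=> cV; have [sh pe ri _ <- _] := cV; have un := conf_uniq cV.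
rewrite -(perm_mem pe) => /entriesP[[i j] hij ->] lt.
rewrite row_of_entry //=; apply/negP => /eqP eqy.
have ej : j = b.2 by move: hij hb eqy; rewrite /y !mem_boxes /=; slim_lia.
move: lt; rewrite ltnNge => /negP; apply; rewrite ej in hij *.
have := hb; move: last_box hij; rewrite -sh; case: (b) => b1 b2 /= lb hij hb'.
by apply: rows_increase_leq => //; move: lb hij hb'; rewrite !mem_boxes /=; slim_lia.
Qed.

(** Mirror image of [down_loop]: [z.-1] has just been passed, and only index [z] may be wrong. As
    [z] grows, [n] bounds the remaining room below the largest entry and carries the induction. *)
Lemma up_loop n z V : (forall v, v \in S -> v < z + n) ->
  conf V z -> z.-1 \in S -> row_of V z.-1 < y ->
  (forall i, i != z -> good V i) ->
  (z.+1 \in S -> tgt z = (row_of V z.-1 < row_of V z.+1)) ->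
  exists W z', [/\ loop_returns T V W, conf W z', forall i, good W i, z <= z'
                 & V = swaps (rev (iota z (z' - z))) W] /\
    [/\ forall v, v < z -> row_of W v = row_of V v,
        forall v, z.-1 <= v < z' -> v \in S /\ row_of W v < y,
        forall v, z.-1 <= v -> v.+1 < z' -> row_of W v < row_of W v.+1
      & ~ [/\ z'.+1 \in S, row_of W z'.+1 < y & row_of W z'.-1 < row_of W z'.+1]].
Proof.
elim: n z V => [|n IH] z V bd cV zpS rp gV tV.
  by have := bd z (conf_mem cV); slim_lia.
have zz := conf_row cV; have zS := conf_mem cV; have z0 := conf_pos cV.
case: (boolP [&& z.+1 \in S, row_of V z.+1 < y & row_of V z.-1 < row_of V z.+1]); last first.
  move=> stop; exists V, z; split; last first.
    split=> // [v hv|v hv|[z1S ry rlt]].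
    - by have -> : v = z.-1 by slim_lia.
    - by slim_lia.
    by move: stop; rewrite z1S ry rlt.
  have gV' i : good V i.
    case: (eqVneq i z) => [-> _ z1S|/gV //].
    (* Were [z.+1] in row [y] itself, the wanted descent would be missing; this is excluded because
       [b] is the last box of its row. *)
    have := conf_row_neq cV z1S (leqnn _).
    rewrite zz tV //; move: stop; rewrite z1S /=.
    by case: (ltnP (row_of V z.+1)) => /=; slim_lia.
  split=> //; first exact: stop_good cV gV'.
  by rewrite subnn.
move=> /and3P[z1S ry rlt].
have tz : tgt z by rewrite tV.
have tz1 i : i.+1 = z -> tgt i.
  move=> iz; have ei : i = z.-1 by slim_lia.
  by rewrite -(gV i) ?iz // ?ei ?zz //; slim_lia.
have sw : swap_index T V z by apply: (step_B cV) => //; rewrite zz ltnW.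
have cV' : conf (swap_entries z V) z.+1.
  have e : swap z z = z.+1 by rewrite /swap eqxx.
  by rewrite -[X in conf _ X]e; apply: conf_swap => //; rewrite ?eqxx // zz; slim_lia.
have [v vS||||hz|W [z' [[lW cW gW zk eV] [rW S1 m1 e1]]]] := IH _ _ _ cV'.
- by have := bd v vS; slim_lia.
- by [].
- by rewrite row_of_swapL.
- move=> i hi iS i1S; case: (eqVneq i z) => [->|nz].
    by rewrite row_of_swapL row_of_swapR zz ry tz.
  case: (eqVneq i.+1 z) => [iz|nz1].
    rewrite tz1 // iz row_of_swapL row_of_swapD; try slim_lia.
    by move: rlt; rewrite -iz.
  by rewrite !row_of_swapD ?gV //; slim_lia.
- by rewrite /= row_of_swapL row_of_swapD -?gV //; slim_lia.
exists W, z'; split; split=> //.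
- exact: Loop_step sw lW.
- exact: ltnW.
- have -> : z' - z = (z' - z.+1).+1 by slim_lia.
  by rewrite /= rev_cons swaps_rcons -eV swap_entriesK.
- by move=> v hv; rewrite rW ?row_of_swapD; slim_lia.
- move=> v hv; case: (eqVneq v z.-1) => [->|nv]; last by apply: S1; slim_lia.
  by rewrite rW ?row_of_swapD //; slim_lia.
move=> v hv hv'; case: (eqVneq v z.-1) => [->|nv]; last by apply: m1; slim_lia.
by rewrite prednK // !rW ?row_of_swapL ?row_of_swapD //; slim_lia.
Qed.

(** The last two hypotheses express that [h] is read last in its column reading. Hence only indices
    [h.-1] and [h] can be wrong at first, each precisely when its other entry lies in a lower row.
    The first swap fixes the direction, and [down_loop] or [up_loop] does the rest. *)
Lemma loop_traced V h : conf V h ->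
  (forall i, i != h -> i.+1 != h -> good V i) ->
  (h.-1 \in S -> ~~ tgt h.-1) -> (h.+1 \in S -> tgt h) ->
  exists W z, [/\ loop_returns T V W, conf W z, forall i, good W i,
    V = unwind z h W & trace S (row_of W) y h z].
Proof.
move=> cV gV th1 th; have rh := conf_row cV; have hS := conf_mem cV.
have h0 := conf_pos cV; have hK := prednK h0.
have rne v : v \in S -> h < v -> row_of V v != y := conf_row_neq cV.
(* [A] means that [h.-1] is in the first set of Step 2, and [B] that [h] is in the second. *)
set A := (h.-1 \in S) && (row_of V h.-1 < y).
set B := (h.+1 \in S) && (row_of V h.+1 < y).
case: (boolP (A && (~~ B || (row_of V h.-1 < row_of V h.+1)))) => [|nA].
  move=> /andP[/andP[pS rp] hB]; have tp := th1 pS.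
  have sw : swap_index T V h.-1.
    case: (boolP B) hB => [/andP[nS rn] /= rlt|nB _].
      have tn := th nS; apply: Swap_below; rewrite ?hK // => j /=.
        case: (eqVneq j h.-1) => [->|ne]; first by rewrite (setAE _ cV) pS hK hS rh rp tp.
        case: (eqVneq j h) => [->|ne']; first by rewrite (setAE _ cV) tn !andbF.
        by rewrite (setA_good cV) //; apply: gV => //; slim_lia.
      case: (eqVneq j h) => [->|ne]; first by rewrite (setBE _ cV) nS hS rh tn ltnW.
      case: (eqVneq j h.-1) => [->|ne']; first by rewrite (setBE _ cV) (negbTE tp) !andbF.
      by rewrite (setB_good cV) //; apply: gV => //; slim_lia.
    apply: (step_A cV); rewrite ?hK ?rh // => j ne.
    case: (eqVneq j h) => [-> _ nS|ne']; last by apply: gV => //; slim_lia.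
    by have := rne _ nS (leqnn _); move: nB; rewrite th // /B nS rh /=; slim_lia.
  have cV' : conf (swap_entries h.-1 V) h.-1.
    have e : swap h.-1 h = h.-1 by rewrite /swap; do ?[case: eqP => ?]; slim_lia.
    by rewrite -[X in conf _ X]e; apply: conf_swap; rewrite ?hK ?eqxx ?orbT // rh; slim_lia.
  have rl : row_of (swap_entries h.-1 V) h.-1 = y by rewrite row_of_swapL hK.
  have rr : row_of (swap_entries h.-1 V) h = row_of V h.-1.
    by rewrite -{2}hK row_of_swapR.
  have rd v : v != h -> v != h.-1 -> row_of (swap_entries h.-1 V) v = row_of V v.
    by move=> n1 n2; rewrite row_of_swapD ?hK.
  have [|||i hi iS|W [z [[lW cW gW zh eV] [rW S1 m1 e1]]]] := down_loop cV'.
  - by rewrite hK.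
  - by rewrite hK rr.
  - move=> i hi iS i1S; case: (eqVneq i h.-1) => [->|nh1].
      by rewrite hK rl rr (negbTE tp); slim_lia.
    case: (eqVneq i h) => [ih|nh]; last by rewrite !rd; try slim_lia; apply: gV => //; slim_lia.
    move: i1S; rewrite ih => nS; rewrite rr rd ?th //; try slim_lia.
    by move: hB; rewrite /B nS /=; slim_lia.
  - by rewrite hK rr rd -?gV ?hi //; slim_lia.
  exists W, z; split=> //; first exact: Loop_step sw lW.
    rewrite /unwind; have -> : z <= h by slim_lia.
    have -> : h - z = (h.-1 - z).+1 by slim_lia.
    rewrite -addn1 iotaD cats1 swaps_rcons -eV subnKC // swap_entriesK //.
  apply: Trace_down => //; first by slim_lia.
  - by move=> v hv; apply: S1; slim_lia.
  - by move=> v hv; apply: m1; slim_lia.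
  (* In [W] the value [h] sits where [h.-1] was in [V], and [h.+1] has not moved: the last clause of
     the trace records the comparison that chose the direction. *)
  move=> [nS rn rle]; move: hB; rewrite /B nS /=.
  by move: rn rle; rewrite !rW; try slim_lia; rewrite rr rd; try slim_lia; rewrite /=; slim_lia.
case: (boolP B) => [/andP[nS rn]|nB].
  have tn := th nS.
  have rle : A -> row_of V h.+1 <= row_of V h.-1.
    by move=> hA; move: nA; rewrite hA /B nS rn /=; slim_lia.
  have sw : swap_index T V h.
    case: (boolP A) => [hA|hA].
      have {}rle := rle hA; move: hA => /andP[pS rp]; have tp := th1 pS.
      rewrite -hK; apply: Swap_above; rewrite ?hK // => j /=.
        case: (eqVneq j h.-1) => [->|ne]; first by rewrite (setAE _ cV) pS hK hS rh rp tp.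
        case: (eqVneq j h) => [->|ne']; first by rewrite (setAE _ cV) tn !andbF.
        by rewrite (setA_good cV) //; apply: gV => //; slim_lia.
      case: (eqVneq j h) => [->|ne]; first by rewrite (setBE _ cV) nS hS rh tn ltnW.
      case: (eqVneq j h.-1) => [->|ne']; first by rewrite (setBE _ cV) (negbTE tp) !andbF.
      by rewrite (setB_good cV) //; apply: gV => //; slim_lia.
    have ley := ltnW rn.
    apply: (step_B cV); rewrite ?rh // => j ne.
    case: (eqVneq j h.-1) => [-> pS _|ne']; last by apply: gV => //; slim_lia.
    by have := th1 pS; move: hA; rewrite hK rh /A pS /=; slim_lia.
  have cV' : conf (swap_entries h V) h.+1.
    have e : swap h h = h.+1 by rewrite /swap eqxx.
    by rewrite -[X in conf _ X]e; apply: conf_swap; rewrite ?eqxx // rh; slim_lia.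
  have rl := row_of_swapL h V; have rr : row_of (swap_entries h V) h.+1 = y.
    by rewrite row_of_swapR.
  have rd v : v != h -> v != h.+1 -> row_of (swap_entries h V) v = row_of V v.
    exact: row_of_swapD.
  have [v vS||||hz|W [z [[lW cW gW zh eV] [rW S1 m1 e1]]]] :=
    @up_loop (\max_(v <- S) v).+1 _ _ _ cV'.
  - by rewrite ltn_addl // ltnS leq_bigmax_seq.
  - by [].
  - by rewrite rl.
  - move=> i hi iS i1S; case: (eqVneq i h) => [->|nh].
      by rewrite rl rr rn tn.
    case: (eqVneq i h.-1) => [ih|nh1]; last by rewrite !rd; try slim_lia; apply: gV => //; slim_lia.
    have pS : h.-1 \in S by rewrite -ih.
    rewrite ih hK rl rd ?(negbTE (th1 pS)) //; try slim_lia.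
    by move: rle; rewrite /A pS /=; slim_lia.
  - by rewrite rl rd -?gV //; slim_lia.
  exists W, z; split=> //; first exact: Loop_step sw lW.
    rewrite /unwind; have -> : z <= h = false by slim_lia.
    have -> : z - h = (z - h.+1).+1 by slim_lia.
    by rewrite /= rev_cons swaps_rcons -eV swap_entriesK.
  apply: Trace_up => //; move=> [pS rp rlt]; move: rle.
  by move: rp rlt; rewrite /A pS !rW; try slim_lia; rewrite rl rd; try slim_lia; rewrite /=; slim_lia.
have {}nA : ~~ A by move: nA; rewrite nB /= andbT.
have gV' i : good V i.
  move=> iS i1S; case: (eqVneq i h) => [ih|n1].
    rewrite ih in i1S *; have := rne _ i1S (leqnn _); move: nB.
    by rewrite th // /B i1S rh /=; slim_lia.
  case: (eqVneq i.+1 h) => [ih|n2]; last exact: gV.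
  have e : i = h.-1 by slim_lia.
  rewrite ih e in iS *; rewrite (negbTE (th1 iS)) rh.
  by move: nA; rewrite /A iS /=; slim_lia.
exists V, h; split=> //; first exact: stop_good cV gV'.
  by rewrite /unwind leqnn subnn.
by apply: Trace_stay => // -[xS xr]; [move: nA | move: nB]; rewrite /A /B xS xr.
Qed.

End Loop.

(** * Determinism of the Algorithm *)

Lemma pred1_inj (p : pred nat) a a' : p =1 pred1 a -> p =1 pred1 a' -> a = a'.
Proof. by move=> e e'; apply/eqP; have := e' a; rewrite e /= eqxx => /esym. Qed.

Lemma pred1_pred0 (p : pred nat) a : p =1 pred1 a -> p =1 pred0 -> False.
Proof. by move=> e e'; have := e' a; rewrite e /= eqxx. Qed.

Lemma swap_index_nonempty T V z : swap_index T V z ->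
  setA T V =1 pred0 -> setB T V =1 pred0 -> False.
Proof.
move=> [a eA _ _|a eA _ _|a eA _|a _ eB] nA nB; try exact: pred1_pred0 eA nA.
exact: pred1_pred0 eB nB.
Qed.

Lemma swap_index_inj T V z z' : swap_index T V z -> swap_index T V z' -> z = z'.
Proof.
move=> [a eA eB lt|a eA eB le|a eA eB|a eA eB]
       [a' eA' eB' lt'|a' eA' eB' le'|a' eA' eB'|a' eA' eB'];
  try (by case: (pred1_pred0 eA eA')); try (by case: (pred1_pred0 eA' eA));
  try (by case: (pred1_pred0 eB eB')); try (by case: (pred1_pred0 eB' eB));
  try exact: pred1_inj eB eB'; have ea := pred1_inj eA eA'; subst a' => //.
- by move: lt le'; rewrite ltnNge => /negP.
- by move: lt' le; rewrite ltnNge => /negP.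
Qed.

Lemma loop_returns_inj T V W W' : loop_returns T V W -> loop_returns T V W' -> W = W'.
Proof.
move=> lW; elim: lW W' => {V W} [V nA nB|V z W sw _ IH] W' lW'.
  by case: lW' nA nB => // {}V z W'' sw _ nA nB; case: (swap_index_nonempty sw).
case: lW' sw IH => [{}V nA nB sw|{}V z' {}W' sw' lW' sw IH].
  by case: (swap_index_nonempty sw).
by apply: IH; rewrite (swap_index_inj sw sw').
Qed.

Lemma trace_eq_mem S S' r y h z : S =i S' -> trace S r y h z -> trace S' r y h z.
Proof.
move=> e [? n1 n2|? m1 ? n1 n2|? m1 ? n1 n2];
  [apply: Trace_stay|apply: Trace_down|apply: Trace_up]; rewrite // -?e //.
all: by move=> v /m1; rewrite e.
Qed.

Lemma index_take (A : eqType) m (s : seq A) a : a \in take m s ->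
  index a (take m s) = index a s.
Proof. by move=> ha; rewrite -[in RHS](cat_take_drop m s) index_cat ha. Qed.

Lemma index_boxes alpha (b b' : nat * nat) : b \in boxes alpha -> b' \in boxes alpha ->
  (index b (boxes alpha) < index b' (boxes alpha)) = box_lt b b'.
Proof.
move=> hb hb'; apply/idP/idP.
  exact: (sorted_ltn_index box_lt_trans (boxes_sorted alpha)).
rewrite ltnNge; apply: contraL; rewrite leq_eqVlt => /predU1P[e|].
  have := congr1 (nth (0, 0) (boxes alpha)) e; rewrite !nth_index // => ->.
  by rewrite box_lt_irr.
move/(sorted_ltn_index box_lt_trans (boxes_sorted alpha) _ _ hb' hb).
by rewrite /box_lt; lia.
Qed.

(** Boxes are counted from 1 and lists from 0; positivity keeps the predecessor from identifying
    coordinates 0 and 1. *)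
Lemma entry_set_box U b b' h : 0 < b.1 -> 0 < b.2 -> 0 < b'.1 -> 0 < b'.2 ->
  entry (set_box U b h) b' = if b' == b then h else entry U b'.
Proof.
case: b b' => [x y] [x' y'] /= x0 y0 x'0 y'0.
rewrite /entry /set_box /= nth_set_nth /= xpair_eqE.
have predE c c' : 0 < c -> 0 < c' -> (c.-1 == c'.-1) = (c == c').
  by case: c c' => [|c] [|c'].
rewrite predE //; case: (eqVneq y' y) => [->|_]; last by rewrite andbF.
by rewrite andbT nth_set_nth /= predE.
Qed.

(** * Adding the next box to a prefix *)

Section NextBox.

Variables (alpha : seq nat) (m : nat) (b : nat * nat).
Hypotheses (hm : m < size (boxes alpha)) (hb : b = nth (0, 0) (boxes alpha) m).

Lemma mem_next_box : b \in boxes alpha.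
Proof. by rewrite hb mem_nth. Qed.

Lemma take_boxes_next : take m.+1 (boxes alpha) = rcons (take m (boxes alpha)) b.
Proof. by rewrite hb -take_nth. Qed.

Lemma next_box_notin : b \notin take m (boxes alpha).
Proof. by rewrite hb in_take_leq ?index_uniq ?boxes_uniq ?ltnn // ltnW. Qed.

Lemma nth_prefix_shape_next j : nth 0 (prefix_shape m.+1 alpha) j =
  nth 0 (prefix_shape m alpha) j + (j == b.2.-1).
Proof.
have := mem_next_box; rewrite mem_boxes => hbb.
case: (ltnP j (size alpha)) => hj; last first.
  by rewrite !nth_default ?size_prefix_shape //; lia.
rewrite -[j]/(j.+1.-1) !nth_prefix_shape // take_boxes_next -cats1 count_cat /= addn0.
by congr addn; lia.
Qed.

(** The box [b] belongs to the longer prefix but not to the shorter one. Thus [set_box] appends to a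
    row and never pads a gap with default entries. *)
Lemma next_box_column : b.1 = (nth 0 (prefix_shape m alpha) b.2.-1).+1.
Proof.
have : b \in take m.+1 (boxes alpha) by rewrite take_boxes_next mem_rcons mem_head.
have := next_box_notin; rewrite -!boxes_prefix_shape !mem_boxes !size_prefix_shape.
by rewrite nth_prefix_shape_next eqxx; lia.
Qed.

Lemma shape_set_next U h : shape U = prefix_shape m alpha ->
  shape (set_box U b h) = prefix_shape m.+1 alpha.
Proof.
move=> sh; have szU : size U = size alpha.
  by rewrite -(size_prefix_shape m) -sh size_map.
have := mem_next_box; rewrite mem_boxes => hbb.
have sz : size (set_box U b h) = size alpha.
  by rewrite /set_box size_set_nth szU; apply/maxn_idPr; lia.
apply: (eq_from_nth (x0 := 0)); rewrite size_map sz ?size_prefix_shape // => j hj.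
rewrite (nth_map [::]) ?sz // nth_prefix_shape_next /set_box nth_set_nth /=.
have nthU k : k < size alpha -> size (nth [::] U k) = nth 0 (prefix_shape m alpha) k.
  by move=> hk; rewrite -sh (nth_map [::]) ?szU.
case: eqVneq => [->|_]; last by rewrite nthU ?addn0.
rewrite size_set_nth nthU; last by lia.
by rewrite next_box_column addn1; apply/maxn_idPl.
Qed.

End NextBox.

Lemma second_box alpha (j : nat) : peak_composition alpha -> 0 < j ->
  (1, j.+1) \in boxes alpha -> (2, j) \in boxes alpha.
Proof. by move=> /peak_compositionP /(_ j.-1); rewrite !mem_boxes /=; lia. Qed.

(** By [two_columns_lt] a lower row cannot hold the larger entry. If [j < j'], no entry fits between
    the two, so the smaller is second in its row and the larger heads its own, which is read
    earlier. In a common row the larger is to the right and read later. *)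
Lemma consecutive_two_columns R (a j a' j' : nat) : peak_composition (shape R) ->
  rows_increase R -> peaks_increase R ->
  (a, j) \in boxes (shape R) -> (a', j') \in boxes (shape R) ->
  a <= 2 -> a' <= 2 -> entry R (a', j') = (entry R (a, j)).+1 ->
  (j < j') = box_lt (a', j') (a, j).
Proof.
move=> pk ri pi hb hb' h2 h2' e; rewrite /box_lt /=.
have [pa pj] : 0 < a /\ 0 < j by move: hb; rewrite mem_boxes /=; clear; lia.
have [pa' pj'] : 0 < a' /\ 0 < j' by move: hb'; rewrite mem_boxes /=; clear; lia.
have one (x k : nat) : (x, k) \in boxes (shape R) -> (1, k) \in boxes (shape R).
  by rewrite !mem_boxes /=; clear; lia.
case: (ltngtP j j') => [jj|jj|ejj].
- have [a2|a1] : a' = 2 \/ a' = 1 by slim_lia.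
    rewrite a2 in hb' e; have := ri 1 j' isT hb'.
    have := two_columns_lt pk ri pi hb h2 jj (one _ _ hb'); slim_lia.
  have [b2|b1] : a = 2 \/ a = 1 by slim_lia.
    by rewrite a1 b2.
  have hs : (2, j) \in boxes (shape R).
    move: pk hb hb' jj => /peak_compositionP /(_ j.-1).
    by rewrite !mem_boxes /=; clear; lia.
  rewrite a1 in e; rewrite b1 in e; have := ri 1 j isT hs.
  have := two_columns_lt pk ri pi hs isT jj (one _ _ hb'); slim_lia.
- have := two_columns_lt pk ri pi hb' h2' jj (one _ _ hb).
  have := rows_increase_leq (i := 1) ri _ hb; rewrite pa => /(_ isT); slim_lia.
subst j'; have [aa|aa] : a' <= a \/ a < a' by slim_lia.
  have := rows_increase_leq (i := a') ri _ hb; rewrite pa' aa => /(_ isT); slim_lia.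
by slim_lia.
Qed.

(** * The invariant of the successive stages *)

Section Stage.

Variables (alpha : seq nat) (T : filling).
Hypotheses (peak : peak_composition alpha) (hT : SPIT alpha T).
Let c := two_columns alpha.
Let w := column_reading T.
Let L := boxes alpha.

Let shT : shape T = alpha. Proof. by have [] := (SPITP T peak).1 hT. Qed.
Let peT : perm_eq (entries T) (iota 1 (sumn alpha)).
Proof. by have [] := (SPITP T peak).1 hT. Qed.
Let riT : rows_increase T. Proof. by have [] := (SPITP T peak).1 hT. Qed.
Let piT : peaks_increase T. Proof. by have [] := (SPITP T peak).1 hT. Qed.
Let unT : uniq (entries T). Proof. by rewrite (perm_uniq peT) iota_uniq. Qed.
Let unw : uniq w. Proof. by rewrite uniq_column_reading. Qed.
Let peakT : peak_composition (shape T). Proof. by rewrite shT. Qed.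
Let szw : size w = size L. Proof. by rewrite size_map shT. Qed.
Let szL : size L = sumn alpha.
Proof. by rewrite -szw (perm_size (perm_column_reading T)) (perm_size peT) size_iota. Qed.
Let posw a : a \in w -> 0 < a.
Proof. by rewrite mem_column_reading (perm_mem peT) mem_iota => /andP[]. Qed.

(** What holds of the filling produced after [m] boxes. [inv_des] is the descent alignment expressed
    through rows; [inv_barrier] says that no entry has crossed a value still to be inserted, which
    makes the next insertion possible. *)
Record invariant (m : nat) (V : filling) : Prop := Invariant {
  inv_shape : shape V = prefix_shape m alpha;
  inv_perm : perm_eq (entries V) (take m w);
  inv_rows : rows_increase V;
  inv_peaks : peaks_increase V;
  inv_des : forall i, i \in take m w -> i.+1 \in take m w ->
    (row_of V i < row_of V i.+1) = (index i.+1 w < index i w);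
  inv_barrier : forall b v, b \in take m L -> v \notin take m w ->
    (entry V b < v) = (entry T b < v) }.

Lemma inv_uniq m V : invariant m V -> uniq (entries V).
Proof. by case=> _ pe *; rewrite (perm_uniq pe) take_uniq. Qed.

Lemma inv_boxes m V : invariant m V -> boxes (shape V) = take m L.
Proof. by move=> iV; rewrite (inv_shape iV) boxes_prefix_shape. Qed.

Lemma inv_Des m V : invariant m V -> Des (row_reading V) =1 Des (take m w).
Proof.
move=> iV i; rewrite Des_row_reading ?(inv_uniq iV) //; last exact: inv_rows iV.
rewrite /Des !(perm_mem (inv_perm iV)).
case: (boolP (i \in _)) => //= hi; case: (boolP (i.+1 \in _)) => //= hi1.
by rewrite (inv_des iV) // !index_take.
Qed.

Lemma shape_restrictT m : c <= m -> shape (restrict m T) = prefix_shape m alpha.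
Proof. by move=> hm; rewrite shape_restrict ?shT. Qed.

Lemma boxes_restrictT m : c <= m -> boxes (shape (restrict m T)) = take m L.
Proof. by move=> hm; rewrite boxes_restrict ?shT. Qed.

Lemma entry_restrictT m b : c <= m -> b \in take m L ->
  entry (restrict m T) b = entry T b.
Proof. by move=> hm hb; rewrite entry_restrict ?shT. Qed.

Lemma column_reading_restrictT m : c <= m ->
  column_reading (restrict m T) = take m w.
Proof. by move=> hm; rewrite column_reading_restrict ?shT. Qed.

Lemma perm_entries_restrict m : c <= m -> perm_eq (entries (restrict m T)) (take m w).
Proof. by move=> hm; rewrite perm_sym -column_reading_restrictT ?perm_column_reading. Qed.

Lemma uniq_entries_restrict m : c <= m -> uniq (entries (restrict m T)).
Proof. by move=> hm; rewrite (perm_uniq (perm_entries_restrict hm)) take_uniq. Qed.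

Lemma peak_restrict m : c <= m -> peak_composition (shape (restrict m T)).
Proof. by move=> hm; rewrite shape_restrictT // peak_prefix_shape. Qed.

Lemma rows_increase_restrict m : c <= m -> rows_increase (restrict m T).
Proof.
move=> hm i j i0 hb.
have hb' : (i, j) \in boxes (shape (restrict m T)) by move: hb; rewrite !mem_boxes /=; lia.
rewrite boxes_restrictT // in hb hb'; rewrite !entry_restrictT //.
by apply: riT => //; rewrite shT; exact: mem_take hb.
Qed.

Lemma peaks_increase_restrict m : c <= m -> peaks_increase (restrict m T).
Proof.
move=> hm j j0 hb; have hb' := second_box (peak_restrict hm) j0 hb.
rewrite boxes_restrictT // in hb hb'; rewrite !entry_restrictT //.
by apply: piT => //; rewrite shT; exact: mem_take hb.
Qed.

Lemma pos_entries m V : perm_eq (entries V) (take m w) -> all (leq 1) (entries V).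
Proof. by move=> pe; apply/allP => a; rewrite (perm_mem pe) => /mem_take/posw. Qed.

Lemma invariant_start : invariant c (restrict c T).
Proof.
have hc := leqnn c.
split; rewrite ?shape_restrictT ?perm_entries_restrict //.
- exact: rows_increase_restrict.
- exact: peaks_increase_restrict.
- move=> i; set R := restrict c T.
  have unR : uniq (entries R) by exact: uniq_entries_restrict.
  have riR : rows_increase R by exact: rows_increase_restrict.
  have piR : peaks_increase R by exact: peaks_increase_restrict.
  have pkR : peak_composition (shape R) by exact: peak_restrict.
  have bE : boxes (shape R) = [seq b <- L | b.1 <= 2].
    by rewrite boxes_restrictT // /c take_two_columns.
  rewrite -!(perm_mem (perm_entries_restrict hc)) => /entriesP[[a j] hb ei].
  move=> /entriesP[[a' j'] hb' ei1].
  have iE b : b \in boxes (shape R) -> index (entry R b) w = index b L.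
    rewrite boxes_restrictT // => hbb; rewrite entry_restrictT // index_entry ?shT //.
    exact: mem_take hbb.
  rewrite {1}ei {1}ei1 !row_of_entry // ei1 ei !iE //.
  have sub b : b \in boxes (shape R) -> b \in L /\ b.1 <= 2.
    by rewrite bE mem_filter => /andP[].
  have [hL h2] := sub _ hb; have [hL' h2'] := sub _ hb'.
  rewrite index_boxes //.
  rewrite -(consecutive_two_columns pkR riR piR hb hb') //=; last by rewrite -ei1 -ei.
  by move: hL hL'; rewrite !mem_boxes /=; clear; lia.
by move=> b v hb _; rewrite entry_restrictT.
Qed.

(** * Inserting one more entry *)

Section Step.

Variables (m : nat) (U : filling).
Hypotheses (hcm : c <= m) (hm : m < size L) (iU : invariant m U).
Let b := nth (0, 0) L m.
Let h := nth 0 w m.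
Let R := restrict m.+1 T.
Let hcm1 : c <= m.+1. Proof. exact: leqW. Qed.
Let hmL : m <= size L. Proof. exact: ltnW. Qed.

Lemma column_reading_next : column_reading R = rcons (take m w) h.
Proof. by rewrite column_reading_restrictT // (take_nth 0) ?szw. Qed.

Lemma mem_next_entries a : (a \in entries R) = (a == h) || (a \in take m w).
Proof. by rewrite -mem_column_reading column_reading_next mem_rcons inE. Qed.

Lemma next_entry_notin : h \notin take m w.
Proof. by rewrite /h in_take_leq ?szw // index_uniq ?szw // ltnn. Qed.

Lemma boxes_next : boxes (shape R) = rcons (take m L) b.
Proof. by rewrite boxes_restrictT // (take_nth (0, 0)). Qed.

Lemma next_in_boxes : b \in boxes (shape R).
Proof. by rewrite boxes_next mem_rcons mem_head. Qed.

Lemma next_box_gt2 : 2 < b.1.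
Proof. by apply: nth_boxes_column; rewrite hcm. Qed.

Lemma entry_next : entry R b = h.
Proof.
rewrite entry_restrictT //; last by rewrite -boxes_restrictT ?next_in_boxes.
by rewrite /h /w /column_reading shT (nth_map (0, 0)).
Qed.

Lemma entry_set_next b' : b' \in boxes (shape R) ->
  entry (set_box U b h) b' = if b' == b then h else entry U b'.
Proof.
have := next_in_boxes; rewrite !mem_boxes => /and4P[? ? _ _] /and4P[? ? _ _].
exact: entry_set_box.
Qed.

Lemma entry_set_old b' : b' \in take m L -> entry (set_box U b h) b' = entry U b'.
Proof.
move=> hb'; rewrite entry_set_next; last by rewrite boxes_next mem_rcons inE hb' orbT.
case: eqP => // e; by have := next_box_notin hm (erefl b); rewrite -e hb'.
Qed.

Lemma entry_set_box_next : entry (set_box U b h) b = h.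
Proof. by rewrite entry_set_next ?eqxx ?next_in_boxes. Qed.

Lemma shape_set : shape (set_box U b h) = shape R.
Proof.
by rewrite shape_restrictT //; apply: shape_set_next => //; exact: inv_shape.
Qed.

Lemma boxes_set : boxes (shape (set_box U b h)) = rcons (take m L) b.
Proof. by rewrite shape_set boxes_next. Qed.

Lemma perm_set : perm_eq (entries (set_box U b h)) (entries R).
Proof.
rewrite -(permPl (perm_column_reading _)) -(permPr (perm_column_reading _)).
rewrite column_reading_next {1}/column_reading boxes_set map_rcons entry_set_box_next.
rewrite -!cats1 perm_cat2r; apply: perm_trans (inv_perm iU).
have -> : [seq entry (set_box U b h) b' | b' <- take m L] = column_reading U.
  by rewrite /column_reading (inv_boxes iU); apply/eq_in_map => b'; apply: entry_set_old.
exact: perm_column_reading.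
Qed.

Lemma old_next b' : b' \in take m L -> b' \in boxes (shape R).
Proof. by rewrite boxes_next mem_rcons inE => ->; rewrite orbT. Qed.

Lemma left_box (i j : nat) : 0 < i -> (i.+1, j) \in rcons (take m L) b ->
  (i, j) \in take m L.
Proof.
have := next_box_column hm (erefl b).
rewrite mem_rcons inE -!boxes_prefix_shape.
move=> bc i0 /predU1P[e|]; last by rewrite !mem_boxes /=; lia.
have := next_in_boxes; move: bc.
rewrite boxes_restrictT // -boxes_prefix_shape !mem_boxes -e /=.
by rewrite !size_prefix_shape; lia.
Qed.

Lemma uniq_set : uniq (entries (set_box U b h)).
Proof. by rewrite (perm_uniq perm_set) uniq_entries_restrict. Qed.

(** The one new inequality is between [h] and its left neighbour. As [h] is absent from [U], the
    barrier transfers it from [T]. The peak inequalities do not involve [b], which is beyond column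
    2. *)
Lemma next_conf : conf R b (set_box U b h) h.
Proof.
split.
- exact: shape_set.
- exact: perm_set.
- move=> i j i0; rewrite boxes_set => hb; have hl := left_box i0 hb.
  rewrite (entry_set_old hl); move: hb; rewrite mem_rcons inE => /predU1P[e|hb].
    rewrite e entry_set_box_next (inv_barrier iU) ?next_entry_notin //.
    rewrite -entry_next -e entry_restrictT //.
      by apply: riT => //; rewrite shT e mem_nth.
    by rewrite -boxes_restrictT // e next_in_boxes.
  by rewrite entry_set_old //; apply: (inv_rows iU) => //; rewrite (inv_boxes iU).
- move=> j j0; rewrite boxes_set mem_rcons inE => /predU1P[e|hb].
    by have := next_box_gt2; rewrite -e.
  have hb2 : (2, j) \in take m L.
    rewrite -boxes_prefix_shape in hb *.
    by apply: second_box => //; exact: peak_prefix_shape.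
  rewrite !entry_set_old //; apply: (inv_peaks iU) => //.
  by rewrite (inv_boxes iU).
- exact: entry_set_box_next.
move=> b' v; rewrite boxes_next mem_rcons inE => hb' hv.
have {hv} : v \notin take m w by apply: contra hv; rewrite mem_next_entries => ->; rewrite orbT.
case/predU1P: hb' => [->|hb'] hv; first by rewrite entry_set_box_next entry_next.
rewrite entry_set_old // (inv_barrier iU) // entry_restrictT //.
by rewrite -boxes_restrictT // old_next.
Qed.

Lemma row_of_set a : a \in take m w -> row_of (set_box U b h) a = row_of U a.
Proof.
rewrite -(perm_mem (inv_perm iU)) => /entriesP[b' hb' ->].
rewrite row_of_entry ?(inv_uniq iU) //; rewrite (inv_boxes iU) in hb'.
by rewrite -(entry_set_old hb') row_of_entry ?uniq_set // shape_set old_next.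
Qed.

Lemma index_next a : a \in entries R -> index a (column_reading R) = index a w.
Proof.
rewrite -mem_column_reading column_reading_restrictT //.
exact: index_take.
Qed.

Lemma index_h : index h w = m.
Proof. by rewrite index_uniq ?szw. Qed.

Lemma index_old a : a \in take m w -> index a w < m.
Proof. by rewrite in_take_leq // szw ltnW. Qed.

Lemma next_run : exists W z,
  [/\ algorithm_returns R U W, invariant m.+1 W,
      set_box U b h = unwind z h W, entry W b = z
    & trace (entries W) (row_of W) b.2.-1 h z].
Proof.
have unR : uniq (entries R) by rewrite uniq_entries_restrict.
have hR : h \in entries R by rewrite mem_next_entries eqxx.
have pR : perm_eq (entries R) (take m.+1 w) by rewrite perm_entries_restrict.
have R0 : 0 \notin entries R.
  by apply/negP; rewrite (perm_mem pR) => /mem_take/posw.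
have pkR : peak_composition (shape R) by rewrite peak_restrict.
have lastb : (b.1.+1, b.2) \notin boxes (shape R).
  apply/negP; rewrite boxes_next => /left_box.
  have := next_box_gt2; have := next_box_notin hm (erefl b).
  by case: (b) => x y /= /negbTE -> x2 /(_ (ltnW (ltnW x2))).
have [|||W [z [lW cW gW eW tW]]] := loop_traced pkR unR R0 next_in_boxes next_box_gt2 lastb next_conf.
- move=> i ih i1h iS i1S; rewrite /good !index_next //.
  move: iS i1S; rewrite !mem_next_entries (negbTE ih) (negbTE i1h) /= => iS i1S.
  by rewrite !row_of_set // (inv_des iU).
(* [h] is at index [m], after every older entry: [h.-1] is then no descent of the column reading,
   and in the next goal [h] is one as soon as [h.+1] occurs. *)
- move=> hS; have h0 : 0 < h by case: (h) hR => //; rewrite (negbTE R0).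
  rewrite prednK // !index_next // index_h -leqNgt.
  move: hS; rewrite mem_next_entries => /predU1P[e|/index_old/ltnW //].
  by rewrite e index_h.
- move=> hS; rewrite !index_next // index_h; apply: index_old.
  by move: hS; rewrite mem_next_entries gtn_eqF.
exists W, z; have [shW peW riW piW eWb baW] := cW.
have pW : perm_eq (entries W) (take m.+1 w) := perm_trans peW pR.
split=> //; last first.
- by apply: trace_eq_mem tW => a; rewrite (perm_mem peW).
- split=> //; first by rewrite shW shape_restrictT.
    move=> i; rewrite -!(perm_mem pR) => iS i1S.
    by have := gW i iS i1S; rewrite !index_next.
  move=> b' v hb' hv; rewrite baW ?(perm_mem pR) ?entry_restrictT //.
  by rewrite boxes_restrictT.
have szU : nboxes U = m.
  by rewrite /nboxes (perm_size (inv_perm iU)) size_takel // szw ltnW.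
split; last first.
  exists b; last by rewrite entry_next.
  by rewrite next_in_boxes entry_next (perm_mem (inv_perm iU)) next_entry_notin.
have RR : restrict (nboxes U) R = restrict m T.
  by rewrite szU restrict_restrict // shT hcm leqnSn.
split; rewrite ?RR.
- split; apply: generalized_SPITP => //.
  + exact: pos_entries pR.
  + exact: rows_increase_restrict.
  + exact: peaks_increase_restrict.
  + by rewrite (inv_shape iU) peak_prefix_shape.
  + exact: inv_uniq iU.
  + exact: pos_entries (inv_perm iU).
  + exact: inv_rows iU.
  exact: inv_peaks iU.
- by rewrite szU /nboxes (perm_size pR) size_takel // szw.
- split; last by rewrite (inv_shape iU) shape_restrictT.
  (* The row of [b] has a part of at least 3, since [b] lies beyond column 2. *)
  apply/hasP; exists (nth 0 (shape R) b.2.-1).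
    have := next_in_boxes; rewrite mem_boxes => /and4P[_ b2 le _].
    by rewrite mem_nth // prednK.
  have := next_in_boxes; rewrite mem_boxes => /and4P[_ _ _].
  exact: leq_trans next_box_gt2.
- move=> a; rewrite (perm_mem (inv_perm iU)).
  by rewrite -(perm_mem (perm_entries_restrict hcm)).
rewrite column_reading_restrictT //; exact: inv_Des.
Qed.

(** [h] is the only entry of [R] missing from [U], and entries are distinct, so the box chosen by
    the Algorithm must be [b]. *)
Lemma algorithm_returns_next W : algorithm_returns R U W ->
  loop_returns R (set_box U b h) W.
Proof.
move=> [_ [b' [hb' +] lW]]; rewrite (perm_mem (inv_perm iU)) => hn.
suff eb : b' = b by move: lW; rewrite eb entry_next.
have := mem_entry hb'; rewrite mem_next_entries (negbTE hn) orbF => /eqP e.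
apply: (entry_inj (T := R)) => //; last by rewrite e entry_next.
  by rewrite uniq_entries_restrict.
exact: next_in_boxes.
Qed.

Lemma set_box_next_inj V : shape V = shape U ->
  set_box U b h = set_box V b h -> U = V.
Proof.
move=> shV e; apply: eq_filling => // b' hb'.
move: (hb'); rewrite (inv_boxes iU) => hL; have := entry_set_old hL; rewrite e => <-.
have := old_next hL; have := next_in_boxes; rewrite !mem_boxes => /and4P[? ? _ _] /and4P[? ? _ _].
rewrite entry_set_box //; case: eqP => // eb.
by have := next_box_notin hm (erefl b); rewrite -eb hL.
Qed.

End Step.

Lemma stage_exists i : c + i <= size L -> exists V,
  [/\ stage c T i V, invariant (c + i) V & forall V', stage c T i V' -> V' = V].
Proof.
elim: i => [|i IH] hi.
  by exists (restrict c T); rewrite addn0; split=> //; exact: invariant_start.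
rewrite addnS in hi *; have [U [sU iU detU]] := IH (ltnW hi).
have [W [z [aW iW _ _ _]]] := next_run (leq_addr i c) hi iU.
exists W; split=> //; first by exists U; rewrite ?addnS.
move=> V' [U' /detU ->]; rewrite addnS => aV'.
apply: loop_returns_inj (algorithm_returns_next _ hi iU aV') (algorithm_returns_next _ hi iU aW);
  exact: leq_addr.
Qed.

Lemma Xi_stage : stage c T (size L - c) (Xi alpha T) /\ invariant (size L) (Xi alpha T).
Proof.
have hc : c <= size L := two_columns_leq_size alpha.
have := @stage_exists (size L - c); rewrite subnKC // => /(_ (leqnn _))[V [sV iV detV]].
suff -> : Xi alpha T = V by [].
by rewrite /Xi -szL; apply: xget_unique.
Qed.

Lemma prefix_shape_full : prefix_shape (size L) alpha = alpha.
Proof.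
apply: (eq_from_nth (x0 := 0)); rewrite size_prefix_shape // => j hj.
rewrite -[j]/(j.+1.-1) nth_prefix_shape // take_size -size_filter.
by rewrite boxes_row // size_map size_iota.
Qed.

Lemma SPIT_Xi : SPIT alpha (Xi alpha T).
Proof.
have [_ [sh pe ri pi _ _]] := Xi_stage; apply/SPITP => //; split=> //.
  by rewrite sh prefix_shape_full.
move: pe; rewrite -szw take_size => /perm_trans; apply.
exact: perm_trans (perm_column_reading T) peT.
Qed.

End Stage.

(** * Injectivity and bijectivity *)

(** Peels off one insertion at a time. The new box depends only on [alpha] and [i]; its entry in [V]
    is the end of the walk, [trace_inj] gives the inserted entry, and [unwind] gives the previous
    filling. Stage [i] sees only a prefix of the column reading, so only that prefix can be
    recovered. *)
Lemma stage_inj alpha T T' i (V : filling) : peak_composition alpha ->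
  SPIT alpha T -> SPIT alpha T' ->
  two_columns alpha + i <= size (boxes alpha) ->
  stage (two_columns alpha) T i V -> stage (two_columns alpha) T' i V ->
  take (two_columns alpha + i) (column_reading T) =
  take (two_columns alpha + i) (column_reading T').
Proof.
move=> pk hT hT'; have [shT _ _ _] := (SPITP T pk).1 hT.
have [shT' _ _ _] := (SPITP T' pk).1 hT'.
have szw : size (column_reading T) = size (boxes alpha) by rewrite size_map shT.
have szw' : size (column_reading T') = size (boxes alpha) by rewrite size_map shT'.
elim: i V => [|i IH] V hi.
  rewrite addn0 => /= -> e.
  by rewrite -(column_reading_restrictT pk hT (leqnn _)) e (column_reading_restrictT pk).
rewrite addnS in hi *; move=> [U sU +] [U' sU' +]; rewrite addnS.
have [U0 [_ iU detU]] := stage_exists pk hT (ltnW hi).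
have [U0' [_ iU' detU']] := stage_exists pk hT' (ltnW hi).
rewrite -(detU _ sU) in iU; rewrite -(detU' _ sU') in iU'.
have hc := leq_addr i (two_columns alpha).
move=> /(algorithm_returns_next pk hT hc hi iU) lV.
move=> /(algorithm_returns_next pk hT' hc hi iU') lV'.
have [W [z [aW iW eW eWb tW]]] := next_run pk hT hc hi iU.
have [W' [z' [aW' iW' eW' eWb' tW']]] := next_run pk hT' hc hi iU'.
have e := loop_returns_inj (algorithm_returns_next pk hT hc hi iU aW) lV; subst W.
have e := loop_returns_inj (algorithm_returns_next pk hT' hc hi iU' aW') lV'; subst W'.
move: tW' eW'; rewrite -eWb' eWb => tW' eW'.
have eh := trace_inj tW tW'.
have eU : U = U'.
  apply: (set_box_next_inj pk hT hc hi iU); first by rewrite (inv_shape iU) (inv_shape iU').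
  by rewrite eW eh -eW'.
rewrite !(take_nth 0) ?szw ?szw' // eh; congr rcons.
by apply: IH sU _ => //; [exact: ltnW | rewrite eU].
Qed.

Lemma Xi_inj alpha T T' : peak_composition alpha ->
  SPIT alpha T -> SPIT alpha T' -> Xi alpha T = Xi alpha T' -> T = T'.
Proof.
move=> pk hT hT' e; have [shT _ _ _] := (SPITP T pk).1 hT.
have [shT' _ _ _] := (SPITP T' pk).1 hT'.
have [sT _] := Xi_stage pk hT; have [sT' _] := Xi_stage pk hT'.
rewrite -e in sT'; have := stage_inj pk hT hT' _ sT sT'.
rewrite subnKC ?two_columns_leq_size // => /(_ (leqnn _)).
rewrite !take_oversize ?size_map ?shT ?shT' //.
rewrite /column_reading shT shT' => /eq_in_map eqe.
by apply: eq_filling; rewrite shT ?shT'.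
Qed.

(** A filling of known shape is recovered from its entries by [reshape], and the entries are one of
    finitely many permutations. *)
Lemma SPIT_enum alpha : peak_composition alpha ->
  exists2 s : seq filling, uniq s & forall T, T \in s <-> SPIT alpha T.
Proof.
move=> pk; pose s := [seq reshape alpha r | r <- permutations (iota 1 (sumn alpha))].
exists (undup [seq T <- s | `[< SPIT alpha T >]]); first exact: undup_uniq.
move=> T; rewrite mem_undup mem_filter; split=> [/andP[/asboolP]//|hT].
rewrite asboolT //=; have [sh pe _ _] := (SPITP T pk).1 hT.
apply/mapP; exists (entries T); last by rewrite -sh flattenK.
by rewrite mem_permutations.
Qed.

Theorem theorem3p14 (alpha : seq nat) (halpha : peak_composition alpha) :
  set_bij (SPIT alpha) (SPIT alpha) (Xi alpha).
Proof.
split.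
- by move=> T; exact: SPIT_Xi.
- by move=> T T' /set_mem hT /set_mem hT'; exact: Xi_inj.
have [s us memS] := SPIT_enum halpha.
have sub : {subset map (Xi alpha) s <= s}.
  by move=> _ /mapP[T /memS hT ->]; apply/memS; exact: SPIT_Xi.
have um : uniq (map (Xi alpha) s).
  by rewrite map_inj_in_uniq // => T T' /memS hT /memS hT'; exact: Xi_inj.
(* The image list is duplicate-free, contained in [s] and equally long, so it has the same members:
   this is surjectivity. *)
have [_ eqm] := uniq_min_size um sub (eq_leq (esym (size_map _ _))).
move=> V /memS; rewrite -eqm => /mapP[T /memS hT ->].
by exists T.
Qed.
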